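(* Let $(A,m,\eta,\Delta,\varepsilon)$ be a bimonoid in $\mathcal C$ and let $(A,L,\alpha)$ be a Lie-Rinehart monoid in $\mathcal C$ (with underlying monoid $(A,m,\eta)$). Then the category $\mathbf{WMod}^{\mathcal C}_A(L)$ of weak modules is a strict monoidal category under the tensor product $$(M;\rho,\gamma)\otimes(M';\rho',\gamma')=(M\otimes M';\rho\boxtimes\rho',\gamma\boxplus\gamma')$$ with unit object $(I;\varepsilon,\mathbf 0)$ if and only if $(A,L,\alpha)$ is a Lie-Rinehart bimonoid.
   Context: Standing setting: $\mathcal C=(\mathcal C,\otimes,I,c)$ is a strict symmetric monoidal category with unit $I$ and symmetric braiding $c_{V,W}:V\otimes W\to W\otimes V$, and it is $\mathbb C$-linear (Hom sets are complex vector spaces; composition and tensor product of morphisms are bilinear). A commutative monoid $(A,m,\eta)$ is an associative unital monoid object with $m\circ c_{A,A}=m$. An $A$-module $(M,\rho)$, $\rho:A\otimes M\to M$, is a left unital associative module. A bimonoid $(A,m,\eta,\Delta,\varepsilon)$ is a monoid and comonoid (coassociative, counital) such that $\Delta$ and $\varepsilon$ are monoid homomorphisms (with $A\otimes A$ a monoid via the braiding). A Lie monoid $(L,\mu)$ is an object $L$ with $\mu:L\otimes L\to L$ such that $\mu=-\mu\circ c_{L,L}$ and $\mu\circ(\mathrm{id}_L\otimes\mu)=\mu\circ(\mu\otimes\mathrm{id}_L)+\mu\circ(\mathrm{id}_L\otimes\mu)\circ(c_{L,L}\otimes\mathrm{id}_L)$. An $L$-module $(M,\gamma)$ is an object $M$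 with $\gamma:L\otimes M\to M$ such that $\gamma\circ(\mathrm{id}_L\otimes\gamma)=\gamma\circ(\mu\otimes\mathrm{id}_M)+\gamma\circ(\mathrm{id}_L\otimes\gamma)\circ(c_{L,L}\otimes\mathrm{id}_M)$. A Lie-Rinehart monoid $(A,m,\eta,L,\mu,\alpha,\beta)$ (abbreviated $(A,L,\alpha)$) consists of a commutative monoid $(A,m,\eta)$, a Lie monoid $(L,\mu)$, an $A$-module structure $\beta:A\otimes L\to L$ on $L$, and a morphism $\alpha:L\otimes A\to A$ (the anchor) such that (i) $\alpha\circ(\mathrm{id}_L\otimes m)=m\circ(\alpha\otimes\mathrm{id}_A)+m\circ(\mathrm{id}_A\otimes\alpha)\circ(c_{L,A}\otimes\mathrm{id}_A)$; (ii) $\alpha\circ(\beta\otimes\mathrm{id}_A)=m\circ(\mathrm{id}_A\otimes\alpha)$; (iii) $\alpha\circ(\mathrm{id}_L\otimes\alpha)=\alpha\circ(\mu\otimes\mathrm{id}_A)+\alpha\circ(\mathrm{id}_L\otimes\alpha)\circ(c_{L,L}\otimes\mathrm{id}_A)$; (iv) $\mu\circ(\mathrm{id}_L\otimes\beta)=\beta\circ(\alpha\otimes\mathrm{id}_L)+\beta\circ(\mathrm{id}_A\otimes\mu)\circ(c_{L,A}\otimes\mathrm{id}_L)$. A weak module $(M;\rho,\gamma)$ over it is an object $M$ with an $A$-module structure $\rho$ and an $L$-module structure $\gamma$ such that $\gamma\circ(\mathrm{id}_L\otimes\rho)=\rho\circ(\alpha\otimes\mathrm{id}_M)+\rho\circ(\mathrm{id}_A\otimes\gamma)\circ(c_{L,A}\otimes\mathrm{id}_M)$.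 Morphisms in $\mathbf{WMod}^{\mathcal C}_A(L)$ are the morphisms of $\mathcal C$ commuting with both the $A$-actions and the $L$-actions; on morphisms the tensor product is that of $\mathcal C$. For weak modules $(M;\rho,\gamma)$, $(M';\rho',\gamma')$: $\rho\boxtimes\rho'=(\rho\otimes\rho')\circ(\mathrm{id}_A\otimes c_{A,M}\otimes\mathrm{id}_{M'})\circ(\Delta\otimes\mathrm{id}_M\otimes\mathrm{id}_{M'})$ and $\gamma\boxplus\gamma'=\gamma\otimes\mathrm{id}_{M'}+(\mathrm{id}_M\otimes\gamma')\circ(c_{L,M}\otimes\mathrm{id}_{M'})$. $\mathbf 0$ is the zero morphism. When $A$ is a bimonoid, the Lie-Rinehart monoid $(A,L,\alpha)$ is called a Lie-Rinehart bimonoid if $\Delta\circ\alpha=(\alpha\otimes\mathrm{id}_A)\circ(\mathrm{id}_L\otimes\Delta)+(\mathrm{id}_A\otimes\alpha)\circ(c_{L,A}\otimes\mathrm{id}_A)\circ(\mathrm{id}_L\otimes\Delta)$ and $\varepsilon\circ\alpha=0$. *)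

(* Defs.v *)
From HB Require Import structures.
From mathcomp Require Import all_boot all_order all_algebra.
From mathcomp Require Import boolp reals complex.

Set Implicit Arguments.
Unset Strict Implicit.
Unset Printing Implicit Defensive.

Import GRing.Theory.

Local Open Scope ring_scope.

Declare Scope cat_scope.
Delimit Scope cat_scope with cat.
Local Open Scope cat_scope.

Reserved Notation "g ∘ f" (at level 40, left associativity).
Reserved Notation "a ⊗ b" (at level 38, left associativity).
Reserved Notation "f ⨂ g" (at level 38, left associativity).

Record category := Category {
  ob :> Type;
  mor : ob -> ob -> Type;
  idm : forall a, mor a a;
  mcomp : forall a b c, mor b c -> mor a b -> mor a c;
  mcompA : forall a b c d (h : mor c d) (g : mor b c) (f : mor a b),
    mcomp h (mcomp g f) = mcomp (mcomp h g) f;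
  mcomp1m : forall a b (f : mor a b), mcomp (idm b) f = f;
  mcompm1 : forall a b (f : mor a b), mcomp f (idm a) = f
}.
Arguments mor {c} a b : rename.
Arguments idm {c} a : rename.
Arguments mcomp {c a b c0} g f : rename.

Notation "g ∘ f" := (mcomp g f) : cat_scope.

(* Equality of two arrows whose endpoints need not be syntactically the same:
   it forces the sources, the targets and the arrows to be equal. *)
Inductive same_arrow (C : category) (a b : C) (f : mor a b) :
    forall a' b' : C, mor a' b' -> Prop :=
  SameArrow : same_arrow f f.

(* The identity morphism, viewed as an arrow between two equal objects. *)
Definition idto (C : category) (a b : C) (e : a = b) : mor a b :=
  match e in _ = y return mor a y with erefl => idm a end.

Record strict_monoidal (C : category) := StrictMonoidal {
  tob : C -> C -> C;
  tunit : C;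
  thom : forall a b a' b' : C,
    mor a b -> mor a' b' -> mor (tob a a') (tob b b');
  thom_id : forall a b : C, thom (idm a) (idm b) = idm (tob a b);
  thom_comp : forall (a b c a' b' c' : C) (g : mor b c) (f : mor a b)
      (g' : mor b' c') (f' : mor a' b'),
    thom (g ∘ f) (g' ∘ f') = thom g g' ∘ thom f f';
  tobA : forall a b c : C, tob (tob a b) c = tob a (tob b c);
  tob1l : forall a : C, tob tunit a = a;
  tob1r : forall a : C, tob a tunit = a;
  thomA : forall (a b a' b' a'' b'' : C)
      (f : mor a b) (f' : mor a' b') (f'' : mor a'' b''),
    same_arrow (thom (thom f f') f'') (thom f (thom f' f''));
  thom1l : forall (a b : C) (f : mor a b), same_arrow (thom (idm tunit) f) f;
  thom1r : forall (a b : C) (f : mor a b), same_arrow (thom f (idm tunit)) f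
}.
Arguments tob {C} s a b : rename.
Arguments tunit {C} s : rename.
Arguments thom {C} s {a b a' b'} f g : rename.

(* All associators and unitors of a strict monoidal category are identities;
   they only appear because equal objects need not be convertible. *)
Definition asc (C : category) (S : strict_monoidal C) (a b c : C) :
    mor (tob S (tob S a b) c) (tob S a (tob S b c)) :=
  idto (tobA S a b c).
Definition ascV (C : category) (S : strict_monoidal C) (a b c : C) :
    mor (tob S a (tob S b c)) (tob S (tob S a b) c) :=
  idto (esym (tobA S a b c)).
Definition lun (C : category) (S : strict_monoidal C) (a : C) :
    mor (tob S (tunit S) a) a := idto (tob1l S a).
Definition run (C : category) (S : strict_monoidal C) (a : C) :
    mor (tob S a (tunit S)) a := idto (tob1r S a).
Definition unit2 (C : category) (S : strict_monoidal C) :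
    mor (tunit S) (tob S (tunit S) (tunit S)) := idto (esym (tob1l S (tunit S))).

Record symmetry (C : category) (S : strict_monoidal C) := Symmetry {
  braid : forall a b : C, mor (tob S a b) (tob S b a);
  braid_nat : forall (a a' b b' : C) (f : mor a a') (g : mor b b'),
    braid a' b' ∘ thom S f g = thom S g f ∘ braid a b;
  braid_hexl : forall a b c : C,
    braid a (tob S b c) ∘ asc S a b c =
    ascV S b c a ∘ thom S (idm b) (braid a c) ∘ asc S b a c
      ∘ thom S (braid a b) (idm c);
  braid_hexr : forall a b c : C,
    braid (tob S a b) c ∘ ascV S a b c =
    asc S c a b ∘ thom S (braid a c) (idm b) ∘ ascV S a c b
      ∘ thom S (idm a) (braid b c);
  braidK : forall a b : C, braid b a ∘ braid a b = idm (tob S a b)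
}.

Record lmod_category (K : comNzRingType) := LmodCategory {
  lcat :> category;
  mor_lmod : forall a b : lcat, GRing.Lmodule K (mor a b)
}.

HB.instance Definition _ (K : comNzRingType) (C : lmod_category K) (a b : C) :=
  @mor_lmod K C a b.

Record linear_category (K : comNzRingType) := LinearCategory {
  lin_lmod :> lmod_category K;
  mcomp_linl : forall (a b c : lin_lmod) (f : mor a b),
    linear (fun g : mor b c => g ∘ f);
  mcomp_linr : forall (a b c : lin_lmod) (g : mor b c),
    linear (fun f : mor a b => g ∘ f)
}.

Record linear_ssmc (K : comNzRingType) := LinearSSMC {
  lin_cat :> linear_category K;
  mon : strict_monoidal lin_cat;
  symm : symmetry mon;
  thom_linl : forall (a b a' b' : lin_cat) (g : mor a' b'),
    linear (fun f : mor a b => thom mon f g);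
  thom_linr : forall (a b a' b' : lin_cat) (f : mor a b),
    linear (fun g : mor a' b' => thom mon f g)
}.

Notation "a ⊗ b" := (tob (mon _) a b) : cat_scope.
Notation "f ⨂ g" := (thom (mon _) f g) : cat_scope.
Notation I_ C := (tunit (mon C)).
Notation id_ a := (idm a).
Notation asc_ a b c := (asc (mon _) a b c).
Notation ascV_ a b c := (ascV (mon _) a b c).
Notation lun_ a := (lun (mon _) a).
Notation run_ a := (run (mon _) a).
Notation c_ a b := (braid (symm _) a b).

Section LieRinehart.
Context (K : comNzRingType) (C : linear_ssmc K).

Record monoid_object := MonoidObject {
  mob :> C;
  mmul : mor (mob ⊗ mob) mob;
  mone : mor (I_ C) mob;
  mmulA : mmul ∘ (mmul ⨂ id_ mob) = mmul ∘ (id_ mob ⨂ mmul) ∘ asc_ mob mob mob;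
  mmul1l : mmul ∘ (mone ⨂ id_ mob) = lun_ mob;
  mmul1r : mmul ∘ (id_ mob ⨂ mone) = run_ mob
}.

Definition commutative_monoid (A : monoid_object) : Prop :=
  mmul A ∘ c_ A A = mmul A.

Record is_module (A : monoid_object) (M : C) (rho : mor (A ⊗ M) M) : Prop :=
  IsModule {
  module_mul :
    rho ∘ (mmul A ⨂ id_ M) = rho ∘ (id_ A ⨂ rho) ∘ asc_ A A M;
  module_one : rho ∘ (mone A ⨂ id_ M) = lun_ M
}.

(* (a ⊗ b) ⊗ (c ⊗ d) -> (a ⊗ c) ⊗ (b ⊗ d), that is, id ⊗ c_{b,c} ⊗ id. *)
Definition interchange (a b c d : C) :
    mor ((a ⊗ b) ⊗ (c ⊗ d)) ((a ⊗ c) ⊗ (b ⊗ d)) :=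
  asc_ (a ⊗ c) b d ∘ (ascV_ a c b ⨂ id_ d)
  ∘ ((id_ a ⨂ c_ b c) ⨂ id_ d)
  ∘ (asc_ a b c ⨂ id_ d) ∘ ascV_ (a ⊗ b) c d.

Record bimonoid := Bimonoid {
  bmon :> monoid_object;
  cmul : mor bmon (bmon ⊗ bmon);
  cone : mor bmon (I_ C);
  cmulA : asc_ bmon bmon bmon ∘ (cmul ⨂ id_ bmon) ∘ cmul
    = (id_ bmon ⨂ cmul) ∘ cmul;
  cmul1l : lun_ bmon ∘ (cone ⨂ id_ bmon) ∘ cmul = id_ bmon;
  cmul1r : run_ bmon ∘ (id_ bmon ⨂ cone) ∘ cmul = id_ bmon;
  cmul_mul : cmul ∘ mmul bmon
    = (mmul bmon ⨂ mmul bmon) ∘ interchange bmon bmon bmon bmon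
      ∘ (cmul ⨂ cmul);
  cmul_one : cmul ∘ mone bmon = (mone bmon ⨂ mone bmon) ∘ unit2 (mon C);
  cone_mul : cone ∘ mmul bmon = lun_ (I_ C) ∘ (cone ⨂ cone);
  cone_one : cone ∘ mone bmon = id_ (I_ C)
}.

Record lie_monoid := LieMonoid {
  lieob :> C;
  bracket : mor (lieob ⊗ lieob) lieob;
  bracket_anti : bracket = - (bracket ∘ c_ lieob lieob);
  bracket_jacobi :
    bracket ∘ (id_ lieob ⨂ bracket) ∘ asc_ lieob lieob lieob
    = bracket ∘ (bracket ⨂ id_ lieob)
      + bracket ∘ (id_ lieob ⨂ bracket) ∘ asc_ lieob lieob lieob
        ∘ (c_ lieob lieob ⨂ id_ lieob)
}.

Definition is_lie_module (L : lie_monoid) (M : C) (gam : mor (L ⊗ M) M) : Prop :=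
  gam ∘ (id_ L ⨂ gam) ∘ asc_ L L M
  = gam ∘ (bracket L ⨂ id_ M)
    + gam ∘ (id_ L ⨂ gam) ∘ asc_ L L M ∘ (c_ L L ⨂ id_ M).

Record lie_rinehart (A : monoid_object) := LieRinehart {
  lrlie :> lie_monoid;
  lract : mor (A ⊗ lrlie) lrlie;
  anchor : mor (lrlie ⊗ A) A;
  lr_comm : commutative_monoid A;
  lr_module : is_module lract;
  anchor_mul :
    anchor ∘ (id_ lrlie ⨂ mmul A) ∘ asc_ lrlie A A
    = mmul A ∘ (anchor ⨂ id_ A)
      + mmul A ∘ (id_ A ⨂ anchor) ∘ asc_ A lrlie A ∘ (c_ lrlie A ⨂ id_ A);
  anchor_act :
    anchor ∘ (lract ⨂ id_ A) = mmul A ∘ (id_ A ⨂ anchor) ∘ asc_ A lrlie A;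
  anchor_bracket :
    anchor ∘ (id_ lrlie ⨂ anchor) ∘ asc_ lrlie lrlie A
    = anchor ∘ (bracket lrlie ⨂ id_ A)
      + anchor ∘ (id_ lrlie ⨂ anchor) ∘ asc_ lrlie lrlie A
        ∘ (c_ lrlie lrlie ⨂ id_ A);
  bracket_act :
    bracket lrlie ∘ (id_ lrlie ⨂ lract) ∘ asc_ lrlie A lrlie
    = lract ∘ (anchor ⨂ id_ lrlie)
      + lract ∘ (id_ A ⨂ bracket lrlie) ∘ asc_ A lrlie lrlie
        ∘ (c_ lrlie A ⨂ id_ lrlie)
}.

Definition lie_rinehart_bimonoid (A : bimonoid) (L : lie_rinehart A) : Prop :=
  cmul A ∘ anchor L
    = (anchor L ⨂ id_ A) ∘ ascV_ L A A ∘ (id_ L ⨂ cmul A)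
      + (id_ A ⨂ anchor L) ∘ asc_ A L A ∘ (c_ L A ⨂ id_ A) ∘ ascV_ L A A
        ∘ (id_ L ⨂ cmul A)
  /\ cone A ∘ anchor L = 0.

(* The triples (M; ρ, γ), with no axiom. *)
Record wdata (A : monoid_object) (L : lie_rinehart A) := WData {
  wob :> C;
  wrho : mor (A ⊗ wob) wob;
  wgam : mor (L ⊗ wob) wob
}.

Record is_weak_module (A : monoid_object) (L : lie_rinehart A) (M : wdata L) : Prop :=
  IsWeakModule {
  weak_module_A : is_module (wrho M);
  weak_module_L : is_lie_module (wgam M);
  weak_module_compat :
    wgam M ∘ (id_ L ⨂ wrho M) ∘ asc_ L A M
    = wrho M ∘ (anchor L ⨂ id_ M)
      + wrho M ∘ (id_ A ⨂ wgam M) ∘ asc_ A L M ∘ (c_ L A ⨂ id_ M)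
}.

Record weak_module (A : monoid_object) (L : lie_rinehart A) := WeakModule {
  wdat :> wdata L;
  wdatP : is_weak_module wdat
}.

Record weak_hom (A : monoid_object) (L : lie_rinehart A) (M N : weak_module L) :=
  WeakHom {
  whom :> mor (wob M) (wob N);
  whom_rho : whom ∘ wrho M = wrho N ∘ (id_ A ⨂ whom);
  whom_gam : whom ∘ wgam M = wgam N ∘ (id_ L ⨂ whom)
}.

Section WMod.
Context (A : monoid_object) (L : lie_rinehart A).

Lemma weak_hom_eq (M N : weak_module L) (f g : weak_hom M N) :
  whom f = whom g -> f = g.
Proof.
case: f g => [f f1 f2] [g g1 g2] /= E; move: g1 g2; rewrite -E => g1 g2.
by rewrite (Prop_irrelevance f1 g1) (Prop_irrelevance f2 g2).
Qed.

Lemma thom_idm_comp (X a b c : C) (g : mor b c) (f : mor a b) :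
  id_ X ⨂ (g ∘ f) = (id_ X ⨂ g) ∘ (id_ X ⨂ f).
Proof. by rewrite -thom_comp mcomp1m. Qed.

Definition weak_id (M : weak_module L) : weak_hom M M.
Proof.
by exists (id_ (wob M)); rewrite thom_id mcomp1m mcompm1.
Defined.

Definition weak_comp (M N P : weak_module L)
    (g : weak_hom N P) (f : weak_hom M N) : weak_hom M P.
Proof.
exists (whom g ∘ whom f).
  by rewrite -mcompA whom_rho mcompA whom_rho thom_idm_comp mcompA.
by rewrite -mcompA whom_gam mcompA whom_gam thom_idm_comp mcompA.
Defined.

Lemma weak_compA (M N P Q : weak_module L)
    (h : weak_hom P Q) (g : weak_hom N P) (f : weak_hom M N) :
  weak_comp h (weak_comp g f) = weak_comp (weak_comp h g) f.
Proof. by apply: weak_hom_eq; rewrite /= mcompA. Qed.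

Lemma weak_comp1m (M N : weak_module L) (f : weak_hom M N) :
  weak_comp (weak_id N) f = f.
Proof. by apply: weak_hom_eq; rewrite /= mcomp1m. Qed.

Lemma weak_compm1 (M N : weak_module L) (f : weak_hom M N) :
  weak_comp f (weak_id M) = f.
Proof. by apply: weak_hom_eq; rewrite /= mcompm1. Qed.

Definition WMod : category := Category weak_compA weak_comp1m weak_compm1.

End WMod.

Section Tensor.
Context (A : bimonoid) (L : lie_rinehart A).

Definition rho_tensor (M M' : C) (rho : mor (A ⊗ M) M)
    (rho' : mor (A ⊗ M') M') : mor (A ⊗ (M ⊗ M')) (M ⊗ M') :=
  (rho ⨂ rho') ∘ interchange A A M M' ∘ (cmul A ⨂ (id_ M ⨂ id_ M')).

Definition gam_tensor (M M' : C) (gam : mor (L ⊗ M) M)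
    (gam' : mor (L ⊗ M') M') : mor (L ⊗ (M ⊗ M')) (M ⊗ M') :=
  (gam ⨂ id_ M') ∘ ascV_ L M M'
  + (id_ M ⨂ gam') ∘ asc_ M L M' ∘ (c_ L M ⨂ id_ M') ∘ ascV_ L M M'.

Definition wdata_tensor (M M' : wdata L) : wdata L :=
  WData (rho_tensor (wrho M) (wrho M')) (gam_tensor (wgam M) (wgam M')).

(* ε itself, as a morphism A = A ⊗ I -> I. *)
Definition wdata_unit : wdata L :=
  @WData A L (I_ C) (cone A ∘ run_ A) 0.

(* The triples of the prescribed tensor products and of the prescribed unit are
   weak modules, and with the tensor product of morphisms of C they make WMod
   a strict monoidal category. *)
Definition wmod_strict_monoidal : Prop :=
  exists S : strict_monoidal (WMod L),
    [/\ forall M M' : weak_module L, wdat (tob S M M') = wdata_tensor M M',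
        wdat (tunit S) = wdata_unit
      & forall (M N M' N' : weak_module L)
          (f : weak_hom M N) (f' : weak_hom M' N'),
          same_arrow (whom (@thom (WMod L) S M N M' N' f f'))
            (whom f ⨂ whom f')].

End Tensor.

End LieRinehart.

(* Main.v *)
(* Associativity of the tensor product holds only up to casts between equal
   objects. A morphism [f] is therefore studied through its whiskerings
   [f ⨂ id_ x] for all [x], read between right-bracketed tensor products, as in
   [w21 f x : a ⊗ (b ⊗ x) -> c ⊗ x] for [f : a ⊗ b -> c]; in this form all the
   associators disappear and the string-diagram calculus becomes rewriting.

   If the compatibilities of Δ and ε with the anchor hold, then [ρ ⊠ ρ'] and
   [γ ⊞ γ'] satisfy the weak-module axioms by direct computation, and
   associativity and unit laws come from coassociativity and counitality.
   Conversely, the compatibility of the unit weak module is [ε ∘ α = 0], and A is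
   a weak module over itself through m and α; the compatibility axiom of A ⊗ A,
   evaluated at 1 ⊗ 1, is the condition on Δ ∘ α because α(l ⊗ 1) = 0. *)
From HB Require Import structures.
From mathcomp Require Import all_boot all_order all_algebra.
From mathcomp Require Import boolp reals complex.
Require Import Defs.

Set Implicit Arguments.
Unset Strict Implicit.
Unset Printing Implicit Defensive.

Import GRing.Theory.
Local Open Scope ring_scope.
Local Open Scope cat_scope.

(** * Arrows up to equality of objects *)

Section SameArrow.
Context (C : category).

Lemma same_arrow_sym (a b a' b' : C) (f : mor a b) (f' : mor a' b') :
  same_arrow f f' -> same_arrow f' f.
Proof. by case. Qed.

Lemma same_arrow_trans (a b a' b' a'' b'' : C) (f : mor a b) (f' : mor a' b')
    (f'' : mor a'' b'') :
  same_arrow f f' -> same_arrow f' f'' -> same_arrow f f''.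
Proof. by move=> + H; case: H. Qed.

(** Replaces the inductive predicate by an equation with explicit casts, on which proof irrelevance
    of object equalities can act. *)
Lemma same_arrow_idto (a b a' b' : C) (f : mor a b) (f' : mor a' b') :
  same_arrow f f' -> exists (ea : a = a') (eb : b = b'),
    f' = idto eb ∘ f ∘ idto (esym ea).
Proof. by case; exists erefl, erefl; rewrite /= mcomp1m mcompm1. Qed.

Lemma same_arrow_eq (a b : C) (f g : mor a b) : same_arrow f g -> f = g.
Proof.
case/same_arrow_idto=> ea [eb ->].
rewrite (Prop_irrelevance ea erefl) (Prop_irrelevance eb erefl) /=.
by rewrite mcomp1m mcompm1.
Qed.

Lemma same_arrow_comp (a b c a' b' c' : C) (g : mor b c) (f : mor a b)
    (g' : mor b' c') (f' : mor a' b') :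
  same_arrow g g' -> same_arrow f f' -> same_arrow (g ∘ f) (g' ∘ f').
Proof.
move=> /same_arrow_idto[eb [ec Eg]] /same_arrow_idto[ea [eb' Ef]].
case: _ / ea eb eb' ec f' Ef g' Eg => eb; case: _ / eb => eb'.
(* Each hypothesis brings its own proof that the middle objects agree; once [eb] is eliminated,
   [eb'] is a loop. *)
rewrite (Prop_irrelevance eb' erefl) => ec; case: _ / ec => /= f' -> g' ->.
by rewrite !mcomp1m !mcompm1.
Qed.

Lemma same_arrow_id (a b : C) : a = b -> same_arrow (idm a) (idm b).
Proof. by case: _ /. Qed.

Lemma idto_same_id (a b c : C) (e : a = b) :
  c = a -> same_arrow (idto e) (idm c).
Proof. by case: _ / e => /= ->. Qed.

Lemma idto_compl (a b c : C) (e : b = c) (f : mor a b) :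
  same_arrow (idto e ∘ f) f.
Proof. by case: _ / e; rewrite /= mcomp1m. Qed.

Lemma idto_compr (a b c : C) (e : a = b) (f : mor b c) :
  same_arrow (f ∘ idto e) f.
Proof. by case: _ / e f => f; rewrite /= mcompm1. Qed.

Lemma idto_comp (a b c : C) (e : a = b) (e' : b = c) :
  idto e' ∘ idto e = idto (etrans e e').
Proof. by case: _ / e'; rewrite mcomp1m. Qed.

Lemma idto_id (a : C) (e : a = a) : idto e = idm a.
Proof. by rewrite (Prop_irrelevance e erefl). Qed.

Lemma idtoK (a b : C) (e : a = b) (e' : b = a) : idto e' ∘ idto e = idm a.
Proof. by rewrite idto_comp idto_id. Qed.

(** The bridge between equality up to endpoints and commuting squares of casts; naturality of
    associators and unitors comes from the strictness laws through it. *)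
Lemma idto_same (a b a' b' : C) (f : mor a b) (f' : mor a' b')
    (ea : a = a') (eb : b = b') :
  same_arrow f f' <-> idto eb ∘ f = f' ∘ idto ea.
Proof.
split=> [H|]; last first.
  by subst a' b'; rewrite /= mcomp1m mcompm1 => ->.
apply/same_arrow_eq; apply: same_arrow_trans (idto_compl _ _) _.
by apply: same_arrow_trans H _; apply/same_arrow_sym/idto_compr.
Qed.

End SameArrow.

Section Strict.
Context (C : category) (S : strict_monoidal C).

Lemma same_arrow_thom (a b c d a' b' c' d' : C) (f : mor a b) (g : mor c d)
    (f' : mor a' b') (g' : mor c' d') :
  same_arrow f f' -> same_arrow g g' ->
  same_arrow (thom S f g) (thom S f' g').
Proof. by case; case. Qed.

Lemma thom_idm_idto (a b c : C) (e : b = c) :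
  thom S (idm a) (idto e) = idto (f_equal (tob S a) e).
Proof. by case: _ / e; rewrite thom_id idto_id. Qed.

Lemma thom_idto_idm (a b c : C) (e : b = c) :
  thom S (idto e) (idm a) = idto (f_equal (fun x => tob S x a) e).
Proof. by case: _ / e; rewrite thom_id idto_id. Qed.

End Strict.

(** * Whiskered morphisms *)

(* Locked: rewriting with associativity of ∘ would otherwise unfold them. *)
HB.lock Definition w21 (K : comNzRingType) (C : linear_ssmc K) (a b c : C)
    (f : mor (a ⊗ b) c) (x : C) : mor (a ⊗ (b ⊗ x)) (c ⊗ x) :=
  (f ⨂ id_ x) ∘ ascV_ a b x.
HB.lock Definition w12 (K : comNzRingType) (C : linear_ssmc K) (a b c : C)
    (f : mor a (b ⊗ c)) (x : C) : mor (a ⊗ x) (b ⊗ (c ⊗ x)) :=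
  asc_ b c x ∘ (f ⨂ id_ x).
HB.lock Definition w10 (K : comNzRingType) (C : linear_ssmc K) (a : C)
    (f : mor a (I_ C)) (x : C) : mor (a ⊗ x) x :=
  lun_ x ∘ (f ⨂ id_ x).
HB.lock Definition w01 (K : comNzRingType) (C : linear_ssmc K) (a : C)
    (f : mor (I_ C) a) (x : C) : mor x (a ⊗ x) :=
  (f ⨂ id_ x) ∘ idto (esym (tob1l (mon C) x)).
(** The crossing of the two leading strands of a right-bracketed product; it composes with the
    whiskered morphisms without any cast. *)
HB.lock Definition sw (K : comNzRingType) (C : linear_ssmc K) (a b x : C) :
    mor (a ⊗ (b ⊗ x)) (b ⊗ (a ⊗ x)) :=
  asc_ b a x ∘ (c_ a b ⨂ id_ x) ∘ ascV_ a b x.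
Arguments w21 {K C a b c} f x.
Arguments w12 {K C a b c} f x.
Arguments w10 {K C a} f x.
Arguments w01 {K C a} f x.
Arguments sw {K C} a b x.

Section Whisker.
Context (K : comNzRingType) (C : linear_ssmc K).
Implicit Types a b c d e x y z : C.

Lemma asc_nat a b c a' b' c' (f : mor a a') (g : mor b b') (h : mor c c') :
  asc_ a' b' c' ∘ ((f ⨂ g) ⨂ h) = (f ⨂ (g ⨂ h)) ∘ asc_ a b c.
Proof. exact/idto_same/thomA. Qed.

Lemma ascV_nat a b c a' b' c' (f : mor a a') (g : mor b b') (h : mor c c') :
  ascV_ a' b' c' ∘ (f ⨂ (g ⨂ h)) = ((f ⨂ g) ⨂ h) ∘ ascV_ a b c.
Proof. exact/idto_same/same_arrow_sym/thomA. Qed.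

Lemma lun_nat a b (f : mor a b) : lun_ b ∘ (id_ (I_ C) ⨂ f) = f ∘ lun_ a.
Proof. exact/idto_same/thom1l. Qed.

Lemma run_nat a b (f : mor a b) : run_ b ∘ (f ⨂ id_ (I_ C)) = f ∘ run_ a.
Proof. exact/idto_same/thom1r. Qed.

Lemma ascVK a b c : ascV_ a b c ∘ asc_ a b c = idm _.
Proof. exact: idtoK. Qed.

Lemma ascK a b c : asc_ a b c ∘ ascV_ a b c = idm _.
Proof. exact: idtoK. Qed.

Lemma lw_comp a b c d (g : mor c d) (f : mor b c) :
  id_ a ⨂ (g ∘ f) = (id_ a ⨂ g) ∘ (id_ a ⨂ f).
Proof. exact: thom_idm_comp. Qed.

Lemma rw_comp a b c d (g : mor c d) (f : mor b c) :
  (g ∘ f) ⨂ id_ a = (g ⨂ id_ a) ∘ (f ⨂ id_ a).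
Proof. by rewrite -thom_comp mcomp1m. Qed.

Lemma thom_lw_rw a b c d (f : mor a b) (g : mor c d) :
  f ⨂ g = (id_ b ⨂ g) ∘ (f ⨂ id_ c).
Proof. by rewrite -thom_comp mcomp1m mcompm1. Qed.

Lemma thom_rw_lw a b c d (f : mor a b) (g : mor c d) :
  f ⨂ g = (f ⨂ id_ d) ∘ (id_ a ⨂ g).
Proof. by rewrite -thom_comp mcomp1m mcompm1. Qed.

Lemma mcompDl a b c (g g' : mor b c) (f : mor a b) :
  (g + g') ∘ f = g ∘ f + g' ∘ f.
Proof. by have := mcomp_linl f 1 g g'; rewrite !scale1r. Qed.

Lemma mcompDr a b c (g : mor b c) (f f' : mor a b) :
  g ∘ (f + f') = g ∘ f + g ∘ f'.
Proof. by have := mcomp_linr g 1 f f'; rewrite !scale1r. Qed.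

Lemma thomDl a b c d (f f' : mor a b) (g : mor c d) :
  (f + f') ⨂ g = f ⨂ g + f' ⨂ g.
Proof. by have := thom_linl g 1 f f'; rewrite !scale1r. Qed.

Lemma thomDr a b c d (f : mor a b) (g g' : mor c d) :
  f ⨂ (g + g') = f ⨂ g + f ⨂ g'.
Proof. by have := thom_linr f 1 g g'; rewrite !scale1r. Qed.

Lemma mcomp0l a b c (f : mor a b) : (0 : mor b c) ∘ f = 0.
Proof. by apply: (addrI (0 ∘ f)); rewrite -mcompDl !addr0. Qed.

Lemma mcomp0r a b c (g : mor b c) : g ∘ (0 : mor a b) = 0.
Proof. by apply: (addrI (g ∘ 0)); rewrite -mcompDr !addr0. Qed.

Lemma thom0l a b c d (g : mor c d) : (0 : mor a b) ⨂ g = 0.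
Proof. by apply: (addrI (0 ⨂ g)); rewrite -thomDl !addr0. Qed.

Lemma thom0r a b c d (f : mor a b) : f ⨂ (0 : mor c d) = 0.
Proof. by apply: (addrI (f ⨂ 0)); rewrite -thomDr !addr0. Qed.

Lemma w21_nat a b c (f : mor (a ⊗ b) c) x y (g : mor x y) :
  w21 f y ∘ (id_ a ⨂ (id_ b ⨂ g)) = (id_ c ⨂ g) ∘ w21 f x.
Proof.
by rewrite w21.unlock -mcompA ascV_nat thom_id mcompA -thom_rw_lw mcompA -thom_lw_rw.
Qed.

Lemma w12_nat a b c (f : mor a (b ⊗ c)) x y (g : mor x y) :
  w12 f y ∘ (id_ a ⨂ g) = (id_ b ⨂ (id_ c ⨂ g)) ∘ w12 f x.
Proof.
by rewrite w12.unlock -mcompA -thom_rw_lw mcompA -asc_nat thom_id -mcompA -thom_lw_rw.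
Qed.

Lemma w10_nat a (f : mor a (I_ C)) x y (g : mor x y) :
  w10 f y ∘ (id_ a ⨂ g) = g ∘ w10 f x.
Proof.
by rewrite w10.unlock -mcompA -thom_rw_lw mcompA -lun_nat -mcompA -thom_lw_rw.
Qed.

Lemma lunV_nat x y (g : mor x y) :
  idto (esym (tob1l (mon C) y)) ∘ g
  = (id_ (I_ C) ⨂ g) ∘ idto (esym (tob1l (mon C) x)).
Proof. exact/idto_same/same_arrow_sym/thom1l. Qed.

Lemma w01_nat a (f : mor (I_ C) a) x y (g : mor x y) :
  w01 f y ∘ g = (id_ a ⨂ g) ∘ w01 f x.
Proof.
by rewrite w01.unlock -mcompA lunV_nat mcompA -thom_rw_lw mcompA -thom_lw_rw.
Qed.

(** * Crossings of strands: naturality, hexagons, unit, Yang-Baxter *)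

Lemma swE a b x : sw a b x = asc_ b a x ∘ (c_ a b ⨂ id_ x) ∘ ascV_ a b x.
Proof. by rewrite sw.unlock. Qed.

Lemma sw_nat3 a b x a' b' x' (f : mor a a') (g : mor b b') (h : mor x x') :
  sw a' b' x' ∘ (f ⨂ (g ⨂ h)) = (g ⨂ (f ⨂ h)) ∘ sw a b x.
Proof.
rewrite sw.unlock -mcompA ascV_nat !mcompA -asc_nat; congr (_ ∘ _).
by rewrite -!mcompA -!thom_comp braid_nat mcomp1m mcompm1.
Qed.

Lemma sw_nat a b x x' (h : mor x x') :
  sw a b x' ∘ (id_ a ⨂ (id_ b ⨂ h)) = (id_ b ⨂ (id_ a ⨂ h)) ∘ sw a b x.
Proof. exact: sw_nat3. Qed.

Lemma swK a b x : sw b a x ∘ sw a b x = idm _.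
Proof.
rewrite sw.unlock -!mcompA (mcompA _ (asc_ _ _ _)) ascVK mcomp1m (mcompA (_ ⨂ _)).
by rewrite -rw_comp braidK thom_id mcomp1m ascK.
Qed.

Lemma sw_same a b x : same_arrow (sw a b x) (c_ a b ⨂ id_ x).
Proof.
by rewrite sw.unlock; apply: same_arrow_trans (idto_compr _ _) (idto_compl _ _).
Qed.

Lemma braid_hexl_same a b c :
  same_arrow (c_ a (b ⊗ c))
    ((id_ b ⨂ c_ a c) ∘ asc_ b a c ∘ (c_ a b ⨂ id_ c)).
Proof.
apply: same_arrow_trans (same_arrow_sym (idto_compr (tobA (mon C) a b c) _)) _.
by rewrite [_ ∘ _]braid_hexl -!mcompA; apply: idto_compl.
Qed.

Lemma braid_hexr_same a b c :
  same_arrow (c_ (a ⊗ b) c)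
    ((c_ a c ⨂ id_ b) ∘ ascV_ a c b ∘ (id_ a ⨂ c_ b c)).
Proof.
apply: same_arrow_trans
  (same_arrow_sym (idto_compr (esym (tobA (mon C) a b c)) _)) _.
by rewrite [_ ∘ _]braid_hexr -!mcompA; apply: idto_compl.
Qed.

Lemma same_arrow_rw x a b a' b' (f : mor a b) (f' : mor a' b') :
  same_arrow f f' -> same_arrow (f ⨂ id_ x) (f' ⨂ id_ x).
Proof. by case. Qed.

Lemma rw_same a b x y (f : mor a b) :
  same_arrow ((f ⨂ id_ x) ⨂ id_ y) (f ⨂ id_ (x ⊗ y)).
Proof. by rewrite -thom_id; apply: thomA. Qed.

Lemma lw_sw_same a b c x :
  same_arrow ((id_ a ⨂ c_ b c) ⨂ id_ x) (id_ a ⨂ sw b c x).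
Proof.
apply: same_arrow_trans (thomA _ _ _ _) _.
by apply: same_arrow_thom => //; apply/same_arrow_sym/sw_same.
Qed.

Lemma sw_swl_same a b c x :
  same_arrow ((c_ a b ⨂ id_ c) ⨂ id_ x) (sw a b (c ⊗ x)).
Proof.
by apply: same_arrow_trans (rw_same _ _ _) _; apply/same_arrow_sym/sw_same.
Qed.

(** The hexagon tensored with [id_ x]: a strand that crosses a pair crosses its members one after
    the other. Once the casts are dropped, the two sides agree factor by factor. *)
Lemma sw_hexl a b c x :
  sw a (b ⊗ c) x ∘ (id_ a ⨂ ascV_ b c x)
  = ascV_ b c (a ⊗ x) ∘ (id_ b ⨂ sw a c x) ∘ sw a b (c ⊗ x).
Proof.
apply: same_arrow_eq; rewrite thom_idm_idto.
apply: same_arrow_trans (idto_compr _ _) _.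
rewrite -mcompA; apply/same_arrow_sym.
apply: same_arrow_trans (idto_compl _ _) _; apply/same_arrow_sym.
apply: same_arrow_trans (sw_same _ _ _) _.
apply: same_arrow_trans (same_arrow_rw _ (braid_hexl_same _ _ _)) _.
rewrite !rw_comp; apply: same_arrow_comp; last exact: sw_swl_same.
rewrite thom_idto_idm; apply: same_arrow_trans (idto_compr _ _) _.
exact: lw_sw_same.
Qed.

Lemma sw_hexr a b c x :
  (id_ c ⨂ asc_ a b x) ∘ sw (a ⊗ b) c x
  = sw a c (b ⊗ x) ∘ (id_ a ⨂ sw b c x) ∘ asc_ a b (c ⊗ x).
Proof.
apply: same_arrow_eq; rewrite thom_idm_idto.
apply: same_arrow_trans (idto_compl _ _) _.
apply/same_arrow_sym.
apply: same_arrow_trans (idto_compr _ _) _; apply/same_arrow_sym.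
apply: same_arrow_trans (sw_same _ _ _) _.
apply: same_arrow_trans (same_arrow_rw _ (braid_hexr_same _ _ _)) _.
rewrite !rw_comp; apply: same_arrow_comp; last exact: lw_sw_same.
rewrite thom_idto_idm; apply: same_arrow_trans (idto_compr _ _) _.
exact: sw_swl_same.
Qed.

(** Here and in the next three lemmas a strand [d] slides past a box: naturality moves the box
    through the crossing, and the hexagon separates the crossings of its two inputs or outputs. *)
Lemma sw_w21r d a b c (f : mor (a ⊗ b) c) x :
  sw d c x ∘ (id_ d ⨂ w21 f x)
  = w21 f (d ⊗ x) ∘ (id_ a ⨂ sw d b x) ∘ sw d a (b ⊗ x).
Proof.
rewrite w21.unlock lw_comp mcompA sw_nat3 thom_id -mcompA sw_hexl.
by rewrite -!mcompA.
Qed.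

Lemma sw_w21l d a b c (f : mor (a ⊗ b) c) x :
  sw c d x ∘ w21 f (d ⊗ x)
  = (id_ d ⨂ w21 f x) ∘ sw a d (b ⊗ x) ∘ (id_ a ⨂ sw b d x).
Proof.
rewrite w21.unlock lw_comp -(thom_id _ d x) mcompA sw_nat3 -!mcompA; congr (_ ∘ _).
rewrite -[LHS]mcomp1m -(thom_id _ d) -(ascVK a b x) lw_comp -!mcompA.
by congr (_ ∘ _); rewrite (mcompA _ (sw _ _ _)) sw_hexr -!mcompA ascK mcompm1.
Qed.

Lemma sw_w12r d a b c (f : mor a (b ⊗ c)) x :
  (id_ b ⨂ sw d c x) ∘ sw d b (c ⊗ x) ∘ (id_ d ⨂ w12 f x)
  = w12 f (d ⊗ x) ∘ sw d a x.
Proof.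
rewrite w12.unlock lw_comp -(thom_id _ d x) -!mcompA -sw_nat3 !mcompA.
congr (_ ∘ _); rewrite -(mcomp1m (_ ∘ sw _ _ _)) -ascK -!mcompA.
by rewrite (mcompA _ _ (sw _ _ _ ∘ _)) (mcompA _ (sw _ _ _)) -sw_hexl
  -!mcompA -lw_comp ascVK thom_id mcompm1.
Qed.

Lemma sw_w12l d a b c (f : mor a (b ⊗ c)) x :
  (id_ d ⨂ w12 f x) ∘ sw a d x
  = sw b d (c ⊗ x) ∘ (id_ b ⨂ sw c d x) ∘ w12 f (d ⊗ x).
Proof.
rewrite w12.unlock lw_comp -(thom_id _ d x) -mcompA -sw_nat3 !mcompA.
by rewrite sw_hexr.
Qed.

Lemma sw_eq a b x a' b' x' :
  a = a' -> b = b' -> x = x' -> same_arrow (sw a b x) (sw a' b' x').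
Proof. by move=> -> -> ->. Qed.

Lemma cast_arrow a b a' b' (ea : a = a') (eb : b = b') (f : mor a b) :
  same_arrow (idto eb ∘ f ∘ idto (esym ea)) f.
Proof. exact: same_arrow_trans (idto_compr _ _) (idto_compl _ _). Qed.

(* The hexagon makes the braiding with the unit an invertible idempotent. *)
Lemma sw1r a x : same_arrow (sw a (I_ C) x) (id_ (a ⊗ x)).
Proof.
have e1 : a ⊗ (I_ C ⊗ x) = a ⊗ x by rewrite tob1l.
have e2 : I_ C ⊗ (a ⊗ x) = a ⊗ x by rewrite tob1l.
have Ht := cast_arrow e1 e2 (sw a (I_ C) x).
have Hu := cast_arrow e2 e1 (sw (I_ C) a x).
set t := _ ∘ _ in Ht; set u := _ ∘ _ in Hu.
have ut : u ∘ t = id_ (a ⊗ x).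
  apply: same_arrow_eq; apply: same_arrow_trans (same_arrow_comp Hu Ht) _.
  by rewrite swK e1.
(* The hexagon for the pair [I ⊗ I] has two crossings on one side and one on the other; since
   [I ⊗ I = I], each of them is [t]. *)
have tt : t ∘ t = t.
  apply: same_arrow_eq; apply: (@same_arrow_trans _ _ _ _ _ _ _ _
    (sw a (I_ C ⊗ I_ C) x ∘ (id_ a ⨂ ascV_ (I_ C) (I_ C) x))).
    rewrite sw_hexl -mcompA.
    apply/same_arrow_sym; apply: same_arrow_trans (idto_compl _ _) _.
    apply: same_arrow_comp.
      by apply: same_arrow_trans (thom1l _ _) _; apply: same_arrow_sym.
    by apply/same_arrow_sym; apply: same_arrow_trans Ht _; apply: sw_eq; rewrite ?tob1l.
  rewrite thom_idm_idto; apply: same_arrow_trans (idto_compr _ _) _.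
  by apply/same_arrow_sym; apply: same_arrow_trans Ht _; apply: sw_eq; rewrite ?tob1l.
apply/same_arrow_sym; suff <- : t = id_ (a ⊗ x) by [].
by rewrite -[t]mcomp1m -ut -mcompA tt.
Qed.

Lemma sw1l a x : same_arrow (sw (I_ C) a x) (id_ (a ⊗ x)).
Proof.
have e : a ⊗ (I_ C ⊗ x) = I_ C ⊗ (a ⊗ x) by rewrite !tob1l.
apply: same_arrow_trans (same_arrow_sym (idto_compr e _)) _.
(* By [sw1r] the chosen cast is itself a crossing, inverse to the one under study. *)
rewrite (_ : idto e = sw a (I_ C) x) ?swK ?tob1l //.
apply: same_arrow_eq; apply: same_arrow_trans (same_arrow_sym (sw1r _ _)).
by apply: idto_same_id; rewrite tob1l.
Qed.

(** Past a box without output, naturality leaves a crossing with the unit, which is trivial by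
    [sw1l]; for a box without input, below, [sw1r] plays this part. *)
Lemma sw_w10 d a (f : mor a (I_ C)) x :
  (id_ d ⨂ w10 f x) ∘ sw a d x = w10 f (d ⊗ x).
Proof.
rewrite w10.unlock lw_comp -(thom_id _ d x) -mcompA -sw_nat3 !mcompA.
congr (_ ∘ _); apply: same_arrow_eq; rewrite thom_idm_idto.
apply: same_arrow_trans (idto_compl _ _) _.
apply: same_arrow_trans (sw1l _ _) _.
by apply/same_arrow_sym/idto_same_id; rewrite tob1l.
Qed.

Lemma sw_w01 d a (f : mor (I_ C) a) x :
  sw d a x ∘ (id_ d ⨂ w01 f x) = w01 f (d ⊗ x).
Proof.
rewrite w01.unlock lw_comp mcompA sw_nat3 thom_id -!mcompA; congr (_ ∘ _).
apply: same_arrow_eq; rewrite thom_idm_idto.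
apply: same_arrow_trans (idto_compr _ _) _.
apply: same_arrow_trans (sw1r _ _) _.
by apply/same_arrow_sym/idto_same_id.
Qed.

Lemma sw_YB a b c x :
  (id_ c ⨂ sw a b x) ∘ (sw a c (b ⊗ x) ∘ (id_ a ⨂ sw b c x))
  = sw b c (a ⊗ x) ∘ ((id_ b ⨂ sw a c x) ∘ sw a b (c ⊗ x)).
Proof.
(* The inserted casts let [sw_hexr] merge two crossings into one of [a ⊗ b] with [c]; naturality of
   that crossing in [c_ a b] is then the Yang-Baxter equation. *)
rewrite -[X in _ ∘ X]mcompm1 -(ascK a b (c ⊗ x)) (mcompA _ (asc_ _ _ _)).
rewrite -sw_hexr [in LHS](swE a b) !lw_comp -!mcompA.
rewrite (mcompA (id_ c ⨂ ascV_ _ _ _)) -lw_comp ascVK thom_id mcomp1m.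
rewrite (mcompA (id_ c ⨂ _) (sw _ _ _)) -sw_nat3 thom_id !mcompA sw_hexr.
by rewrite [in RHS](swE a b) -!mcompA.
Qed.

(** Bracketing the source to the right, without ([w30]) or with ([w31]) an extra strand, turns an
    axiom into its whiskered form. Injectivity of [w30] gives the way back. *)
Definition w30 a b c d (h : mor ((a ⊗ b) ⊗ c) d) : mor (a ⊗ (b ⊗ c)) d :=
  h ∘ ascV_ a b c.
Definition w31 a b c d (h : mor ((a ⊗ b) ⊗ c) d) x :
    mor (a ⊗ (b ⊗ (c ⊗ x))) (d ⊗ x) :=
  (h ⨂ id_ x) ∘ ascV_ (a ⊗ b) c x ∘ ascV_ a b (c ⊗ x).

Lemma w30_inj a b c d (h h' : mor ((a ⊗ b) ⊗ c) d) : w30 h = w30 h' -> h = h'.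
Proof.
move=> E; rewrite -[h]mcompm1 -[h']mcompm1 -(ascVK a b c) !mcompA.
by congr (_ ∘ _).
Qed.

Lemma w30D a b c d (h h' : mor ((a ⊗ b) ⊗ c) d) :
  w30 (h + h') = w30 h + w30 h'.
Proof. exact: mcompDl. Qed.

Lemma w30_w21 a b c d e (f : mor (d ⊗ c) e) (g : mor (a ⊗ b) d) :
  w30 (f ∘ (g ⨂ id_ c)) = f ∘ w21 g c.
Proof. by rewrite /w30 w21.unlock -mcompA. Qed.

Lemma w30_lw a b c d e (f : mor (a ⊗ d) e) (g : mor (b ⊗ c) d) :
  w30 (f ∘ (id_ a ⨂ g) ∘ asc_ a b c) = f ∘ (id_ a ⨂ g).
Proof. by rewrite /w30 -mcompA ascK mcompm1. Qed.

Lemma w30_sw a b c d (h : mor ((b ⊗ a) ⊗ c) d) :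
  w30 (h ∘ (c_ a b ⨂ id_ c)) = w30 h ∘ sw a b c.
Proof.
by rewrite /w30 sw.unlock -!mcompA (mcompA (ascV_ _ _ _)) ascVK mcomp1m.
Qed.

Lemma w31D a b c d (h h' : mor ((a ⊗ b) ⊗ c) d) x :
  w31 (h + h') x = w31 h x + w31 h' x.
Proof. by rewrite /w31 thomDl !mcompDl. Qed.

Lemma w31_w21 a b c d e (f : mor (d ⊗ c) e) (g : mor (a ⊗ b) d) x :
  w31 (f ∘ (g ⨂ id_ c)) x = w21 f x ∘ w21 g (c ⊗ x).
Proof.
rewrite /w31 w21.unlock rw_comp -!mcompA; congr (_ ∘ _).
by rewrite mcompA -ascV_nat thom_id -mcompA.
Qed.

Lemma w31_lw a b c d e (f : mor (a ⊗ d) e) (g : mor (b ⊗ c) d) x :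
  w31 (f ∘ (id_ a ⨂ g) ∘ asc_ a b c) x = w21 f x ∘ (id_ a ⨂ w21 g x).
Proof.
rewrite /w31 w21.unlock !rw_comp lw_comp -!mcompA; congr (_ ∘ _).
rewrite [RHS]mcompA ascV_nat -[RHS]mcompA; congr (_ ∘ _).
rewrite thom_idm_idto thom_idto_idm !idto_comp; congr idto.
exact: Prop_irrelevance.
Qed.

Lemma w31_sw a b c d (h : mor ((b ⊗ a) ⊗ c) d) x :
  w31 (h ∘ (c_ a b ⨂ id_ c)) x = w31 h x ∘ sw a b (c ⊗ x).
Proof.
rewrite /w31 sw.unlock rw_comp -!mcompA; congr (_ ∘ _).
rewrite (mcompA (ascV_ b a _)) ascVK mcomp1m mcompA -ascV_nat thom_id.
by rewrite -mcompA.
Qed.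

(** Up to casts both sides are [id ⊗ c ⊗ id], so a single crossing replaces the interchange. *)
Lemma interchangeE a b c d :
  interchange a b c d
  = ascV_ a c (b ⊗ d) ∘ (id_ a ⨂ sw b c d) ∘ asc_ a b (c ⊗ d).
Proof.
apply: same_arrow_eq; rewrite -mcompA; apply/same_arrow_sym.
apply: same_arrow_trans (idto_compl _ _) _.
apply: same_arrow_trans (idto_compr _ _) _.
apply: same_arrow_trans (same_arrow_sym (lw_sw_same _ _ _ _)) _.
apply/same_arrow_sym; rewrite /interchange !thom_idto_idm -!mcompA.
apply: same_arrow_trans (idto_compl _ _) _.
apply: same_arrow_trans (idto_compl _ _) _.
by rewrite idto_comp; apply: same_arrow_trans (idto_compr _ _) _.
Qed.

(** With its companions below, this applies an equation inside a composite nested to the right,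
    possibly under a whiskering on the left. *)
Lemma reassoc2 a b c d (f : mor b c) (g : mor a b) (h : mor a c) (u : mor d a) :
  f ∘ g = h -> f ∘ (g ∘ u) = h ∘ u.
Proof. by move=> <-; rewrite mcompA. Qed.

Lemma reassoc3 a b c d e (f : mor b c) (g : mor a b) (k : mor e a) (h : mor e c)
    (u : mor d e) :
  f ∘ (g ∘ k) = h -> f ∘ (g ∘ (k ∘ u)) = h ∘ u.
Proof. by move=> <-; rewrite !mcompA. Qed.

Lemma lw_comp2 p a b c (f : mor b c) (g : mor a b) (h : mor a c) :
  f ∘ g = h -> (id_ p ⨂ f) ∘ (id_ p ⨂ g) = id_ p ⨂ h.
Proof. by move=> <-; rewrite lw_comp. Qed.

Lemma lw_comp3 p a b c e (f : mor b c) (g : mor a b) (k : mor e a) (h : mor e c) :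
  f ∘ (g ∘ k) = h ->
  (id_ p ⨂ f) ∘ ((id_ p ⨂ g) ∘ (id_ p ⨂ k)) = id_ p ⨂ h.
Proof. by move=> <-; rewrite !lw_comp. Qed.

End Whisker.

(** * Whiskered axioms *)

Section Structures.
Context (K : comNzRingType) (C : linear_ssmc K).

Lemma same_w12 (a b c : C) (f : mor a (b ⊗ c)) x :
  same_arrow (w12 f x) (f ⨂ id_ x).
Proof. by rewrite w12.unlock; apply: idto_compl. Qed.

Lemma same_w21 (a b c : C) (f : mor (a ⊗ b) c) x :
  same_arrow (w21 f x) (f ⨂ id_ x).
Proof. by rewrite w21.unlock; apply: idto_compr. Qed.

Lemma same_w10 (a : C) (f : mor a (I_ C)) x : same_arrow (w10 f x) (f ⨂ id_ x).
Proof. by rewrite w10.unlock; apply: idto_compl. Qed.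

Lemma same_w01 (a : C) (f : mor (I_ C) a) x : same_arrow (w01 f x) (f ⨂ id_ x).
Proof. by rewrite w01.unlock; apply: idto_compr. Qed.

Lemma same_lw (p a b c d x : C) (f : mor a b) (g : mor c d) :
  same_arrow g (f ⨂ id_ x) -> same_arrow (id_ p ⨂ g) ((id_ p ⨂ f) ⨂ id_ x).
Proof.
move=> H; apply/same_arrow_sym; apply: same_arrow_trans (thomA _ _ _ _) _.
by apply: same_arrow_thom => //; apply/same_arrow_sym.
Qed.

Lemma same_shift (a b c d x y : C) (f : mor a b) (g : mor c d) :
  same_arrow g (f ⨂ id_ (x ⊗ y)) -> same_arrow g ((f ⨂ id_ x) ⨂ id_ y).
Proof.
by move/same_arrow_trans; apply; apply/same_arrow_sym/rw_same.
Qed.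

Lemma same_sum (a b a' b' : C) (f g : mor a b) (f' g' : mor a' b') :
  same_arrow f f' -> same_arrow g g' -> same_arrow (f + g) (f' + g').
Proof.
move=> Hf Hg; have [ea [eb _]] := same_arrow_idto Hf.
subst a' b'.
by rewrite (same_arrow_eq Hf) (same_arrow_eq Hg).
Qed.

(** * Modules, Lie modules and weak modules in whiskered form *)

Section Module.
Context (A : monoid_object C) (M : C) (rho : mor (A ⊗ M) M).
Hypothesis rhoP : is_module rho.

Lemma module_w21 : rho ∘ w21 (mmul A) M = rho ∘ (id_ A ⨂ rho).
Proof.
by have /(congr1 (@w30 _ _ _ _ _ _)) := module_mul rhoP; rewrite w30_w21 w30_lw.
Qed.

Lemma module_w21x x :
  w21 rho x ∘ w21 (mmul A) (M ⊗ x) = w21 rho x ∘ (id_ A ⨂ w21 rho x).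
Proof.
by have /(congr1 (fun h => w31 h x)) := module_mul rhoP; rewrite w31_w21 w31_lw.
Qed.

Lemma module_w01 : rho ∘ w01 (mone A) M = id_ M.
Proof. by rewrite w01.unlock mcompA (module_one rhoP) idtoK. Qed.

Lemma module_w01x x : w21 rho x ∘ w01 (mone A) (M ⊗ x) = id_ (M ⊗ x).
Proof.
apply: same_arrow_eq.
apply: same_arrow_trans (same_arrow_comp (same_w21 _ _)
  (same_shift (same_w01 _ _))) _.
rewrite -rw_comp -[X in same_arrow _ X]thom_id.
(* The identity of [M] is expanded by the unit law, so that both sides become the same composite
   tensored with [x]. *)
rewrite -[X in same_arrow _ (X ⨂ _)]module_w01 w01.unlock.
rewrite !rw_comp thom_idto_idm mcompA.
by apply/same_arrow_sym; apply: idto_compr.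
Qed.

End Module.

Lemma is_module_w (A : monoid_object C) (M : C) (rho : mor (A ⊗ M) M) :
  rho ∘ w21 (mmul A) M = rho ∘ (id_ A ⨂ rho) -> rho ∘ w01 (mone A) M = id_ M ->
  is_module rho.
Proof.
move=> H1 H2; split; first by apply: w30_inj; rewrite w30_w21 w30_lw.
rewrite -[RHS]mcomp1m -[in RHS]H2 w01.unlock -!mcompA; congr (_ ∘ _).
by rewrite /lun idtoK mcompm1.
Qed.

Lemma lie_module_w (L : lie_monoid C) (M : C) (gam : mor (L ⊗ M) M) :
  is_lie_module gam <->
  gam ∘ (id_ L ⨂ gam)
  = gam ∘ w21 (bracket L) M + gam ∘ ((id_ L ⨂ gam) ∘ sw L L M).
Proof.
split=> [/(congr1 (@w30 _ _ _ _ _ _))|H].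
  by rewrite w30D w30_w21 w30_sw w30_lw -mcompA.
by apply: w30_inj; rewrite w30D w30_w21 w30_sw w30_lw -mcompA.
Qed.

Lemma lie_module_wx (L : lie_monoid C) (M : C) (gam : mor (L ⊗ M) M) x :
  is_lie_module gam ->
  w21 gam x ∘ (id_ L ⨂ w21 gam x)
  = w21 gam x ∘ w21 (bracket L) (M ⊗ x)
    + w21 gam x ∘ ((id_ L ⨂ w21 gam x) ∘ sw L L (M ⊗ x)).
Proof.
move=> /(congr1 (fun h => w31 h x)).
by rewrite w31D w31_w21 w31_sw w31_lw -mcompA.
Qed.

Definition weak_compat (A : monoid_object C) (L : lie_rinehart A) (M : C)
    (rho : mor (A ⊗ M) M) (gam : mor (L ⊗ M) M) : Prop :=
  gam ∘ (id_ L ⨂ rho)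
  = rho ∘ w21 (anchor L) M + rho ∘ ((id_ A ⨂ gam) ∘ sw L A M).

Section WeakModule.
Context (A : monoid_object C) (L : lie_rinehart A).

Lemma weak_compatP (M : wdata L) :
  wgam M ∘ (id_ L ⨂ wrho M) ∘ asc_ L A M
    = wrho M ∘ (anchor L ⨂ id_ M)
      + wrho M ∘ (id_ A ⨂ wgam M) ∘ asc_ A L M ∘ (c_ L A ⨂ id_ M)
  <-> weak_compat (wrho M) (wgam M).
Proof.
rewrite /weak_compat; split=> [/(congr1 (@w30 _ _ _ _ _ _))|H].
  by rewrite w30D w30_w21 w30_sw !w30_lw -mcompA.
by apply: w30_inj; rewrite w30D w30_w21 w30_sw !w30_lw -mcompA.
Qed.

Lemma weak_compatx (M : wdata L) x : is_weak_module M ->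
  w21 (wgam M) x ∘ (id_ L ⨂ w21 (wrho M) x)
  = w21 (wrho M) x ∘ w21 (anchor L) (M ⊗ x)
    + w21 (wrho M) x ∘ ((id_ A ⨂ w21 (wgam M) x) ∘ sw L A (M ⊗ x)).
Proof.
case=> _ _ /(congr1 (fun h => w31 h x)).
by rewrite w31D w31_w21 w31_sw !w31_lw -mcompA.
Qed.

End WeakModule.

(** * Bimonoid laws in whiskered form *)

Section Bimonoid.
Context (A : bimonoid C).
Local Notation D := (cmul A).
Local Notation E := (cone A).
Local Notation m := (mmul A).
Local Notation u := (mone A).

Lemma cmulAx x :
  (id_ A ⨂ w12 D x) ∘ w12 D x = w12 D (A ⊗ x) ∘ w12 D x.
Proof.
apply: same_arrow_eq.
apply: same_arrow_trans (same_arrow_comp (same_lw _ (same_w12 _ _))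
  (same_w12 _ _)) _.
rewrite -rw_comp -cmulA -mcompA rw_comp thom_idto_idm.
apply: same_arrow_trans (idto_compl _ _) _.
rewrite rw_comp; apply/same_arrow_sym; apply: same_arrow_comp (same_w12 _ _).
exact/same_shift/same_w12.
Qed.

Lemma cmul1lx x : w10 E (A ⊗ x) ∘ w12 D x = id_ (A ⊗ x).
Proof.
apply: same_arrow_eq.
apply: same_arrow_trans (same_arrow_comp (same_shift (same_w10 _ _))
  (same_w12 _ _)) _.
rewrite -rw_comp -[X in same_arrow _ X]thom_id.
rewrite -[X in same_arrow _ (X ⨂ _)](cmul1l A) -mcompA rw_comp.
rewrite [X in same_arrow _ X]rw_comp thom_idto_idm.
by apply/same_arrow_sym; apply: same_arrow_trans (idto_compl _ _) _; rewrite rw_comp.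
Qed.

Lemma cmul1rx x : (id_ A ⨂ w10 E x) ∘ w12 D x = id_ (A ⊗ x).
Proof.
apply: same_arrow_eq.
apply: same_arrow_trans (same_arrow_comp (same_lw _ (same_w10 _ _))
  (same_w12 _ _)) _.
rewrite -rw_comp -[X in same_arrow _ X]thom_id.
rewrite -[X in same_arrow _ (X ⨂ _)](cmul1r A) -mcompA rw_comp.
rewrite [X in same_arrow _ X]rw_comp thom_idto_idm.
by apply/same_arrow_sym; apply: same_arrow_trans (idto_compl _ _) _; rewrite rw_comp.
Qed.

Lemma cmul_onex x : w12 D x ∘ w01 u x = w01 u (A ⊗ x) ∘ w01 u x.
Proof.
apply: same_arrow_eq.
apply: same_arrow_trans (same_arrow_comp (same_w12 _ _) (same_w01 _ _)) _.
rewrite -rw_comp cmul_one rw_comp thom_idto_idm.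
apply: same_arrow_trans (idto_compr _ _) _.
rewrite (thom_rw_lw u) rw_comp; apply/same_arrow_sym.
apply: same_arrow_comp; first exact/same_shift/same_w01.
apply: same_arrow_trans (same_w01 _ _) _.
by apply/same_arrow_rw/same_arrow_sym/thom1l.
Qed.

Lemma cone_onex x : w10 E x ∘ w01 u x = id_ x.
Proof.
apply: same_arrow_eq.
apply: same_arrow_trans (same_arrow_comp (same_w10 _ _) (same_w01 _ _)) _.
by rewrite -rw_comp cone_one; apply: thom1l.
Qed.

Lemma cone_mulx x : w10 E x ∘ w21 m x = w10 E x ∘ w10 E (A ⊗ x).
Proof.
apply: same_arrow_eq.
apply: same_arrow_trans (same_arrow_comp (same_w10 _ _) (same_w21 _ _)) _.
rewrite -rw_comp cone_mul rw_comp thom_idto_idm.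
apply: same_arrow_trans (idto_compl _ _) _.
rewrite (thom_lw_rw E) rw_comp; apply/same_arrow_sym.
apply: same_arrow_comp; last exact/same_shift/same_w10.
apply: same_arrow_trans (same_w10 _ _) _.
by apply/same_arrow_rw/same_arrow_sym/thom1l.
Qed.

Lemma cmul_mulx x :
  w12 D x ∘ w21 m x
  = w21 m (A ⊗ x) ∘ ((id_ A ⨂ (id_ A ⨂ w21 m x)) ∘
      ((id_ A ⨂ sw A A (A ⊗ x)) ∘ (w12 D (A ⊗ (A ⊗ x)) ∘ (id_ A ⨂ w12 D x)))).
Proof.
apply: same_arrow_eq.
apply: same_arrow_trans (same_arrow_comp (same_w12 _ _) (same_w21 _ _)) _.
(* Splitting [m ⨂ m] and [D ⨂ D] into successive whiskerings gives both sides the same sequence of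
   factors, matched one by one below. *)
rewrite -rw_comp cmul_mul (thom_rw_lw m) (thom_rw_lw D) interchangeE.
rewrite !rw_comp !thom_idto_idm -!mcompA.
apply/same_arrow_sym; apply: same_arrow_comp.
  exact/same_shift/same_w21.
apply: same_arrow_comp.
  apply: same_arrow_trans (same_arrow_sym (thomA _ _ _ _)) _.
  rewrite thom_id; apply/same_arrow_sym; apply: same_arrow_trans (thomA _ _ _ _) _.
  by apply: same_arrow_thom => //; apply/same_arrow_sym/same_w21.
apply/same_arrow_sym; apply: same_arrow_trans (idto_compl _ _) _.
apply/same_arrow_sym; apply: same_arrow_comp.
  apply: same_lw; apply/same_arrow_sym.
  by apply: same_arrow_trans (same_arrow_rw _ (sw_same _ _ _)) _; apply: sw_swl_same.
apply/same_arrow_sym; apply: same_arrow_trans (idto_compl _ _) _.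
apply/same_arrow_sym; apply: same_arrow_comp; last exact/same_lw/same_w12.
apply: same_shift; apply: same_arrow_trans (same_w12 _ _) _.
by apply: same_arrow_thom => //; apply: same_arrow_id; rewrite tobA.
Qed.

End Bimonoid.
Section LieRinehartBimonoid.
Context (A : bimonoid C) (L : lie_rinehart A).

Lemma lr_bimonoid_w :
  cmul A ∘ anchor L
    = (anchor L ⨂ id_ A) ∘ ascV_ L A A ∘ (id_ L ⨂ cmul A)
      + (id_ A ⨂ anchor L) ∘ asc_ A L A ∘ (c_ L A ⨂ id_ A) ∘ ascV_ L A A
        ∘ (id_ L ⨂ cmul A)
  <-> cmul A ∘ anchor L
    = w21 (anchor L) A ∘ (id_ L ⨂ cmul A)
      + (id_ A ⨂ anchor L) ∘ (sw L A A ∘ (id_ L ⨂ cmul A)).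
Proof. by rewrite w21.unlock sw.unlock -!mcompA. Qed.

Hypothesis LP : lie_rinehart_bimonoid L.

Lemma cmul_anchorx x :
  w12 (cmul A) x ∘ w21 (anchor L) x
  = w21 (anchor L) (A ⊗ x) ∘ (id_ L ⨂ w12 (cmul A) x)
    + (id_ A ⨂ w21 (anchor L) x)
      ∘ (sw L A (A ⊗ x) ∘ (id_ L ⨂ w12 (cmul A) x)).
Proof.
apply: same_arrow_eq.
apply: same_arrow_trans (same_arrow_comp (same_w12 _ _) (same_w21 _ _)) _.
rewrite -rw_comp; have [/lr_bimonoid_w -> _] := LP.
rewrite thomDl !rw_comp; apply: same_sum; apply/same_arrow_sym.
  apply: same_arrow_comp; last exact/same_lw/same_w12.
  apply: same_arrow_trans (same_shift (same_w21 _ _)) _.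
  exact/same_arrow_rw/same_arrow_sym/same_w21.
apply: same_arrow_comp; first exact/same_lw/same_w21.
apply: same_arrow_comp; last exact/same_lw/same_w12.
apply: same_arrow_trans (same_shift (sw_same _ _ _)) _.
exact/same_arrow_rw/same_arrow_sym/sw_same.
Qed.

End LieRinehartBimonoid.
End Structures.

(** * Tensor products of modules *)

Section Tensor.
Context (K : comNzRingType) (C : linear_ssmc K) (A : bimonoid C).
Local Notation D := (cmul A).

(** Sequential form: duplicate the [A] strand, carry the second copy past [M], act on [M], then on
    [M']. *)
Lemma rho_tensorE (M M' : C) (rho : mor (A ⊗ M) M) (rho' : mor (A ⊗ M') M') :
  rho_tensor rho rho'
  = (id_ M ⨂ rho') ∘ (w21 rho (A ⊗ M') ∘
      ((id_ A ⨂ sw A M M') ∘ w12 D (M ⊗ M'))).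
Proof.
rewrite /rho_tensor interchangeE (thom_lw_rw rho) thom_id w21.unlock w12.unlock.
by rewrite -!mcompA.
Qed.

Lemma gam_tensorE (L : lie_rinehart A) (M M' : C)
    (gam : mor (L ⊗ M) M) (gam' : mor (L ⊗ M') M') :
  gam_tensor gam gam' = w21 gam M' + (id_ M ⨂ gam') ∘ sw L M M'.
Proof. by rewrite /gam_tensor w21.unlock sw.unlock -!mcompA. Qed.

(** Serves associativity of the tensor product, where [M ⊗ M'] is the first factor and its action
    appears whiskered. *)
Lemma w21_rho_tensor (M M' : C) (rho : mor (A ⊗ M) M)
    (rho' : mor (A ⊗ M') M') x :
  asc_ M M' x ∘ w21 (rho_tensor rho rho') x
  = (id_ M ⨂ w21 rho' x) ∘ (w21 rho (A ⊗ (M' ⊗ x)) ∘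
      ((id_ A ⨂ sw A M (M' ⊗ x)) ∘ (w12 D (M ⊗ (M' ⊗ x)) ∘
        (id_ A ⨂ asc_ M M' x)))).
Proof.
apply: same_arrow_eq; apply: same_arrow_trans (idto_compl _ _) _.
apply: same_arrow_trans (same_w21 _ _) _; apply/same_arrow_sym.
rewrite rho_tensorE !rw_comp.
apply: same_arrow_comp; first exact/same_lw/same_w21.
apply: same_arrow_comp.
  apply: same_arrow_trans (same_arrow_sym (same_arrow_rw _ (same_w21 _ _))).
  apply: same_shift; apply: same_arrow_trans (same_w21 _ _) _.
  by apply: same_arrow_thom => //; apply: same_arrow_id; rewrite tobA.
apply: same_arrow_comp.
  apply: same_lw; apply/same_arrow_sym.
  by apply: same_arrow_trans (same_arrow_rw _ (sw_same _ _ _)) _; apply: sw_swl_same.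
rewrite thom_idm_idto; apply: same_arrow_trans (idto_compr _ _) _.
apply: same_arrow_trans (same_arrow_sym (same_arrow_rw _ (same_w12 _ _))).
apply: same_shift; apply: same_arrow_trans (same_w12 _ _) _.
by apply: same_arrow_thom => //; apply: same_arrow_id; rewrite tobA.
Qed.

Lemma w21_gam_tensor (L : lie_rinehart A) (M M' : C)
    (gam : mor (L ⊗ M) M) (gam' : mor (L ⊗ M') M') x :
  asc_ M M' x ∘ w21 (gam_tensor gam gam') x
  = w21 gam (M' ⊗ x) ∘ (id_ L ⨂ asc_ M M' x)
    + (id_ M ⨂ w21 gam' x) ∘ (sw L M (M' ⊗ x) ∘ (id_ L ⨂ asc_ M M' x)).
Proof.
apply: same_arrow_eq; apply: same_arrow_trans (idto_compl _ _) _.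
apply: same_arrow_trans (same_w21 _ _) _; apply/same_arrow_sym.
rewrite gam_tensorE thomDl !rw_comp thom_idm_idto; apply: same_sum.
  apply: same_arrow_trans (idto_compr _ _) _.
  apply: same_arrow_trans (same_arrow_sym (same_arrow_rw _ (same_w21 _ _))).
  exact/same_shift/same_w21.
apply: same_arrow_comp; first exact/same_lw/same_w21.
apply: same_arrow_trans (idto_compr _ _) _.
apply: same_arrow_trans (same_arrow_sym (same_arrow_rw _ (sw_same _ _ _))).
exact/same_shift/sw_same.
Qed.

(** A trailing identity lets [reassoc2] reach the last two factors of a composite too. *)
Lemma eq_mcompm1 a b (f g : @mor C a b) : f ∘ id_ a = g ∘ id_ a -> f = g.
Proof. by rewrite !mcompm1. Qed.

Lemma sw_w01l (d a : C) (f : mor (I_ C) a) x :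
  sw a d x ∘ w01 f (d ⊗ x) = id_ d ⨂ w01 f x.
Proof. by rewrite -sw_w01 mcompA swK mcomp1m. Qed.

(** * The tensor product of two [A]-modules *)

Section Module.
Context (M M' : C) (rho : mor (A ⊗ M) M) (rho' : mor (A ⊗ M') M').
Hypotheses (rhoP : is_module rho) (rhoP' : is_module rho').

(** Multiplicativity of [Δ] splits the action of a product, associativity of [rho] and [rho']
    applies on each factor, and sliding lemmas align the crossings. The unit law comes from
    [Δ(1) = 1 ⊗ 1]. *)
Lemma rho_tensor_module : is_module (rho_tensor rho rho').
Proof.
apply: is_module_w.
  apply: eq_mcompm1; rewrite rho_tensorE !lw_comp -!mcompA.
  rewrite (reassoc2 _ (cmul_mulx _ _)) -!mcompA.
  rewrite (reassoc2 _ (esym (w21_nat (mmul A) _))) -!mcompA.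
  rewrite (reassoc2 _ (module_w21x rhoP _)) -!mcompA.
  rewrite (reassoc2 _ (lw_comp2 _ (lw_comp2 _ (sw_w21l _ _ _)))) !lw_comp -!mcompA.
  rewrite (reassoc2 _ (lw_comp2 _ (w21_nat rho _))) lw_comp -!mcompA.
  rewrite (reassoc2 _ (w21_nat rho _)) -!mcompA.
  rewrite (reassoc2 _ (lw_comp2 M (module_w21 rhoP'))) lw_comp -!mcompA.
  do ?[rewrite (reassoc2 _ (w12_nat D _)) -!mcompA].
  rewrite (reassoc2 _ (lw_comp2 _ (sw_nat _ _ _))) lw_comp -!mcompA.
  rewrite (reassoc2 _ (w21_nat rho _)) -!mcompA.
  rewrite (reassoc2 _ (lw_comp2 _ (sw_w21r _ _ _))) !lw_comp -!mcompA.
  by rewrite (reassoc2 _ (lw_comp2 _ (sw_nat A A _))) lw_comp -!mcompA.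
rewrite rho_tensorE -!mcompA cmul_onex.
rewrite (reassoc2 _ (esym (w01_nat _ _))) -!mcompA.
rewrite (reassoc2 _ (module_w01x rhoP _)) mcomp1m.
by rewrite sw_w01l -lw_comp module_w01 // thom_id.
Qed.

End Module.

(** * The tensor product of two Lie modules *)

Section Lie.
Context (L : lie_rinehart A) (M M' : C).
Context (gam : mor (L ⊗ M) M) (gam' : mor (L ⊗ M') M').
Hypotheses (gamP : is_lie_module gam) (gamP' : is_lie_module gam').

(** Write the action as [g1 + g2], one summand per factor. Each summand satisfies the Lie module law
    alone, and the two mixed terms are exchanged by swapping the copies of [L], so they cancel. *)
Lemma gam_tensor_lie : is_lie_module (gam_tensor gam gam').
Proof.
apply/lie_module_w; rewrite gam_tensorE.
set g1 := w21 gam M'; set g2 := _ ∘ sw L M M'.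
have E11 : g1 ∘ (id_ L ⨂ g1)
    = g1 ∘ w21 (bracket L) (M ⊗ M') + g1 ∘ ((id_ L ⨂ g1) ∘ sw L L (M ⊗ M')).
  exact: lie_module_wx.
have E21 : g2 ∘ (id_ L ⨂ g1) = g1 ∘ ((id_ L ⨂ g2) ∘ sw L L (M ⊗ M')).
  rewrite /g1 /g2 !lw_comp -!mcompA sw_w21r.
  by rewrite [RHS](reassoc2 _ (w21_nat gam _)) -!mcompA.
have E12 : g1 ∘ (id_ L ⨂ g2) = g2 ∘ ((id_ L ⨂ g1) ∘ sw L L (M ⊗ M')).
  (* Precomposing [E21] with the swap of the two copies of [L], an involution, gives the other mixed
     identity. *)
  by rewrite mcompA E21 -!mcompA swK mcompm1.
have E22 : g2 ∘ (id_ L ⨂ g2)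
    = g2 ∘ w21 (bracket L) (M ⊗ M') + g2 ∘ ((id_ L ⨂ g2) ∘ sw L L (M ⊗ M')).
  rewrite /g2 !lw_comp -!mcompA (reassoc2 _ (sw_nat L M gam')) -!mcompA.
  rewrite (reassoc2 _ (lw_comp2 _ (iffLR (lie_module_w _) gamP'))) thomDr mcompDl.
  rewrite !lw_comp -!mcompA sw_w21l -!mcompA; congr (_ + _).
  rewrite (reassoc2 _ (sw_nat L M gam')) -!mcompA.
  by rewrite sw_YB.
rewrite thomDr !mcompDl !mcompDr E11 E22 E21 E12 -!addrA; congr (_ + _).
rewrite [RHS]addrCA; congr (_ + _).
rewrite [LHS]addrCA [RHS]addrCA; congr (_ + _).
by rewrite addrCA.
Qed.

End Lie.

(** * Compatibility of the two actions on a tensor product *)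

Section Weak.
Context (L : lie_rinehart A) (LP : lie_rinehart_bimonoid L).

(** The compatibilities of [M] and [M'] expand one side into four terms; on the other side the
    coproduct rule for the anchor splits the anchor term in two. *)
Lemma weak_compat_tensor (M M' : wdata L) :
  is_weak_module M -> is_weak_module M' ->
  weak_compat (rho_tensor (wrho M) (wrho M')) (gam_tensor (wgam M) (wgam M')).
Proof.
move=> MP MP'; rewrite /weak_compat rho_tensorE gam_tensorE.
apply: eq_mcompm1; rewrite thomDr !(mcompDl, mcompDr).
have MP'w := iffLR (weak_compatP _) (weak_module_compat MP').
rewrite -!mcompA (reassoc2 _ (cmul_anchorx LP _)) !lw_comp -!mcompA.
rewrite !(mcompDl, mcompDr) -!mcompA.
rewrite (reassoc2 _ (w21_nat (wgam M) _)) -!mcompA (reassoc2 _ (weak_compatx _ MP)).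
rewrite !(mcompDl, mcompDr) -!mcompA.
rewrite (reassoc2 _ (sw_nat L M (wrho M'))) -!mcompA (reassoc2 _ (lw_comp2 _ MP'w)).
rewrite thomDr mcompDl !lw_comp -!mcompA addrACA.
(* In order: the anchor on the first copy of [A], the anchor on the second copy, [L] acting on [M],
   [L] acting on [M']. *)
congr (_ + _ + (_ + _)).
- by rewrite (reassoc2 _ (esym (w21_nat (anchor L) _))) -!mcompA.
- rewrite (reassoc2 _ (lw_comp2 _ (sw_w21l _ _ _))) !lw_comp -!mcompA.
  rewrite (reassoc2 _ (w21_nat (wrho M) _)) -!mcompA.
  rewrite (reassoc2 _ (sw_w21r _ _ _)) -!mcompA.
  by rewrite (reassoc2 _ (sw_nat L A (sw A M M'))) -!mcompA.
- rewrite (reassoc2 _ (w12_nat D _)) -!mcompA.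
  rewrite (reassoc2 _ (lw_comp2 _ (sw_w21r _ _ _))) !lw_comp -!mcompA.
  rewrite (reassoc2 _ (esym (sw_w12r _ _ _))) -!mcompA.
  (* The strand [L] has crossed the second copy of [A] and come back; symmetry of the braiding
     removes the detour. *)
  rewrite (reassoc2 _ (lw_comp2 _ (swK _ _ _))) thom_id mcomp1m.
  by rewrite (reassoc2 _ (sw_nat L A (sw A M M'))) -!mcompA.
rewrite (reassoc2 _ (sw_w21r _ _ _)) -!mcompA.
rewrite (reassoc2 _ (sw_nat L A (sw A M M'))) -!mcompA.
do ![rewrite (reassoc2 _ (w12_nat D _)) -!mcompA].
rewrite (reassoc2 _ (lw_comp2 _ (sw_nat A M _))) lw_comp -!mcompA.
rewrite (reassoc2 _ (w21_nat (wrho M) _)) -!mcompA.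
rewrite (reassoc2 _ (esym (sw_w12r _ _ _))) -!mcompA.
(* Yang-Baxter for [L], the second copy of [A] and [M]. *)
rewrite (reassoc3 _ (lw_comp3 _ (esym (sw_YB _ _ _ _)))) !lw_comp -!mcompA.
by rewrite (reassoc2 _ (w21_nat (wrho M) _)) -!mcompA.
Qed.

End Weak.
End Tensor.

(** * Unitors and associators against whiskered morphisms *)

Section UnitLaws.
Context (K : comNzRingType) (C : linear_ssmc K).

(** Presents the action on the unit object as a whiskering. The left and right unitors at [I] are
    casts between the same objects, hence equal. *)
Lemma w10I (a : C) (f : mor a (I_ C)) : w10 f (I_ C) = f ∘ run_ a.
Proof.
rewrite w10.unlock -run_nat; congr (_ ∘ _); congr idto.
exact: Prop_irrelevance.
Qed.

Lemma lun_w21 (a : C) (f : mor a (I_ C)) x :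
  lun_ x ∘ w21 (f ∘ run_ a) x = w10 f x ∘ (id_ a ⨂ lun_ x).
Proof.
apply: same_arrow_eq; rewrite thom_idm_idto w10.unlock -[in X in same_arrow _ X]mcompA.
apply: same_arrow_trans (idto_compl _ _) _.
apply/same_arrow_sym; apply: same_arrow_trans (idto_compl _ _) _.
apply: same_arrow_trans (idto_compr _ _) _; apply/same_arrow_sym.
apply: same_arrow_trans (same_w21 _ _) _.
exact/same_arrow_rw/idto_compr.
Qed.

Lemma lun_sw (a x : C) :
  lun_ (a ⊗ x) ∘ sw a (I_ C) x = id_ a ⨂ lun_ x.
Proof.
apply: same_arrow_eq; rewrite thom_idm_idto.
apply: same_arrow_trans (idto_compl _ _) _.
apply: same_arrow_trans (sw1r _ _) _.
by apply/same_arrow_sym/idto_same_id; rewrite tob1l.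
Qed.

Lemma run_w21 (a b c : C) (f : mor (a ⊗ b) c) :
  run_ c ∘ w21 f (I_ C) = f ∘ (id_ a ⨂ run_ b).
Proof.
rewrite w21.unlock mcompA run_nat -mcompA; congr (_ ∘ _).
by rewrite thom_idm_idto idto_comp; congr idto; apply: Prop_irrelevance.
Qed.

Lemma asc_sw (a b c x : C) :
  asc_ b c (a ⊗ x) ∘ sw a (b ⊗ c) x
  = (id_ b ⨂ sw a c x) ∘ (sw a b (c ⊗ x) ∘ (id_ a ⨂ asc_ b c x)).
Proof.
rewrite -[in LHS](mcompm1 (sw _ _ _)) -thom_id -(ascVK b c x) lw_comp.
by rewrite (mcompA (sw _ _ _)) sw_hexl -!mcompA (mcompA (asc_ _ _ _)) ascK mcomp1m.
Qed.

Lemma interchange_nat (a b c d a' b' c' d' : C) (f : mor a a') (g : mor b b')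
    (h : mor c c') (k : mor d d') :
  interchange a' b' c' d' ∘ ((f ⨂ g) ⨂ (h ⨂ k))
  = ((f ⨂ h) ⨂ (g ⨂ k)) ∘ interchange a b c d.
Proof.
rewrite !interchangeE -!mcompA asc_nat (mcompA (_ ⨂ sw _ _ _)) -thom_comp.
rewrite sw_nat3 mcomp1m -[X in X ⨂ _]mcompm1 thom_comp !mcompA.
by rewrite ascV_nat.
Qed.

End UnitLaws.

(** * The strict monoidal structure *)

Section Monoidal.
Context (K : comNzRingType) (C : linear_ssmc K).

(** * Equality of weak modules and of their morphisms *)

Section Equality.
Context (A : monoid_object C) (L : lie_rinehart A).

(** Reduces equality of triples to the cast intertwining both actions, a statement that diagram
    rewriting can prove. *)
Lemma wdata_eq (M N : wdata L) (e : wob M = wob N) :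
  idto e ∘ wrho M = wrho N ∘ (id_ A ⨂ idto e) ->
  idto e ∘ wgam M = wgam N ∘ (id_ L ⨂ idto e) -> M = N.
Proof.
case: M N e => [M r g] [N r' g'] /= e; case: _ / e r' g' => r' g' /=.
by rewrite !thom_id !mcomp1m !mcompm1 => -> ->.
Qed.

Lemma weak_module_eq (M N : weak_module L) : wdat M = wdat N -> M = N.
Proof.
case: M N => [M PM] [N PN] /= e; case: _ / e PN => PN.
by rewrite (Prop_irrelevance PM PN).
Qed.

Lemma weak_hom_same (M N M' N' : weak_module L) (f : weak_hom M N)
    (f' : weak_hom M' N') :
  M = M' -> N = N' -> same_arrow (whom f) (whom f') ->
  @same_arrow (WMod L) M N f M' N' f'.
Proof.
move=> eM eN; subst M' N' => /same_arrow_eq H.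
by rewrite (weak_hom_eq H).
Qed.

End Equality.

Context (A : bimonoid C) (L : lie_rinehart A).

(** For [A] this is coassociativity, after the duplicated strand is moved past [M]. For [L] both
    sides are the same sum of three terms, [L] acting on one factor after crossing those to its
    left. *)
Lemma wdata_tensorA (M M' M'' : wdata L) :
  wdata_tensor (wdata_tensor M M') M'' = wdata_tensor M (wdata_tensor M' M'').
Proof.
apply: (@wdata_eq A L (wdata_tensor (wdata_tensor M M') M'')
  (wdata_tensor M (wdata_tensor M' M'')) (tobA (mon C) M M' M'')) => /=.
  rewrite (rho_tensorE _ (rho_tensor _ _)) [in RHS](rho_tensorE (wrho M')).
  rewrite (rho_tensorE (rho_tensor _ _)) -(thom_id _ M M') mcompA asc_nat.
  rewrite -mcompA (reassoc2 _ (w21_rho_tensor _ _ _)) -!mcompA.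
  rewrite (reassoc2 _ (lw_comp2 _ (asc_sw _ _ _ _))) !lw_comp -!mcompA.
  rewrite -(w12_nat (cmul A)).
  do ?[rewrite (reassoc2 _ (w12_nat (cmul A) _)) -!mcompA].
  rewrite (reassoc2 _ (esym (cmulAx _ _))) -!mcompA.
  rewrite (reassoc2 _ (lw_comp2 _ (sw_nat A M _))) lw_comp -!mcompA.
  rewrite (reassoc2 _ (w21_nat (wrho M) _)) -!mcompA.
  rewrite (reassoc3 _ (lw_comp3 _ (etrans (mcompA _ _ _) (esym (sw_w12l _ _ _))))).
  by rewrite !lw_comp -!mcompA (reassoc2 _ (w21_nat (wrho M) _)) -!mcompA.
rewrite (gam_tensorE _ (gam_tensor _ _)) [in RHS](gam_tensorE (wgam M')).
rewrite (gam_tensorE (gam_tensor _ _)) mcompDr w21_gam_tensor.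
rewrite -(thom_id _ M M') (mcompA _ (_ ⨂ _)) asc_nat -mcompA asc_sw.
by rewrite thomDr !mcompDl lw_comp -!mcompA addrA.
Qed.

(** The unit absorbs the first copy of [A] through the counit law, and the zero action removes the
    first summand of the [L]-action. *)
Lemma wdata_tensor1l (M : wdata L) : wdata_tensor (wdata_unit L) M = M.
Proof.
apply: (@wdata_eq A L (wdata_tensor (wdata_unit L) M) M (tob1l (mon C) M)) => /=.
  rewrite rho_tensorE (reassoc2 _ (lun_nat _)) -mcompA.
  rewrite (reassoc2 _ (lun_w21 _ _)) -!mcompA.
  rewrite (reassoc2 _ (lw_comp2 _ (lun_sw _ _))) -(w12_nat (cmul A)).
  by rewrite (mcompA (w10 _ _)) cmul1lx mcomp1m.
rewrite gam_tensorE w21.unlock thom0l mcomp0l add0r (reassoc2 _ (lun_nat _)) -mcompA.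
by rewrite lun_sw.
Qed.

Lemma wdata_tensor1r (M : wdata L) : wdata_tensor M (wdata_unit L) = M.
Proof.
apply: (@wdata_eq A L (wdata_tensor M (wdata_unit L)) M (tob1r (mon C) M)) => /=.
  rewrite rho_tensorE -w10I (reassoc2 _ (esym (w21_nat _ _))) -mcompA.
  rewrite (reassoc2 _ (lw_comp2 _ (sw_w10 _ _ _))) cmul1rx mcompm1.
  exact: run_w21.
by rewrite gam_tensorE thom0r mcomp0l addr0; apply: run_w21.
Qed.

Lemma rho_tensor_hom (M N M' N' : C) (rM : mor (A ⊗ M) M) (rN : mor (A ⊗ N) N)
    (rM' : mor (A ⊗ M') M') (rN' : mor (A ⊗ N') N') (f : mor M N)
    (f' : mor M' N') :
  f ∘ rM = rN ∘ (id_ A ⨂ f) -> f' ∘ rM' = rN' ∘ (id_ A ⨂ f') ->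
  (f ⨂ f') ∘ rho_tensor rM rM' = rho_tensor rN rN' ∘ (id_ A ⨂ (f ⨂ f')).
Proof.
move=> Ef Ef'; rewrite /rho_tensor.
move: (interchange_nat (id_ A) (id_ A) f f') => H.
(* Abstracting the interchanges keeps associativity rewriting from entering their definition. *)
move: (interchange A A M M') (interchange A A N N') H => i j H.
rewrite !mcompA -thom_comp Ef Ef' thom_comp -(mcompA (rN ⨂ rN')) -H -!mcompA.
by rewrite -!thom_comp !thom_id !mcomp1m !mcompm1.
Qed.

Lemma gam_tensor_hom (M N M' N' : C) (gM : mor (L ⊗ M) M) (gN : mor (L ⊗ N) N)
    (gM' : mor (L ⊗ M') M') (gN' : mor (L ⊗ N') N') (f : mor M N)
    (f' : mor M' N') :
  f ∘ gM = gN ∘ (id_ L ⨂ f) -> f' ∘ gM' = gN' ∘ (id_ L ⨂ f') ->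
  (f ⨂ f') ∘ gam_tensor gM gM' = gam_tensor gN gN' ∘ (id_ L ⨂ (f ⨂ f')).
Proof.
move=> Ef Ef'; rewrite !gam_tensorE mcompDr mcompDl w21.unlock; congr (_ + _).
  rewrite mcompA -thom_comp Ef mcompm1 -[in RHS]mcompA ascV_nat mcompA.
  by rewrite -thom_comp mcomp1m.
rewrite mcompA -thom_comp Ef' mcompm1 -[in RHS]mcompA sw_nat3 mcompA.
by rewrite -thom_comp mcomp1m.
Qed.

(** With the zero [L]-action, compatibility says that [ε ∘ α], whiskered by the unit object,
    vanishes. *)
Lemma wdata_unit_weak : cone A ∘ anchor L = 0 -> is_weak_module (wdata_unit L).
Proof.
move=> H; split=> /=.
- rewrite -w10I; apply: is_module_w; last exact: cone_onex.
  by rewrite cone_mulx w10_nat.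
- by rewrite /is_lie_module !mcomp0l addr0.
rewrite -w10I !mcomp0l thom0r !(mcomp0l, mcomp0r) addr0 w10.unlock -mcompA.
by rewrite -rw_comp H thom0l mcomp0r.
Qed.

Lemma anchor_cone_unit : is_weak_module (wdata_unit L) -> cone A ∘ anchor L = 0.
Proof.
case=> _ _ /=; rewrite !mcomp0l thom0r !(mcomp0l, mcomp0r) addr0 -w10I.
rewrite w10.unlock -mcompA -rw_comp => /esym H.
have E : lun_ (I_ C) = run_ (I_ C).
  by congr idto; apply: Prop_irrelevance.
(* The right unitor is invertible, so it can be cancelled from the whiskered equation. *)
move: H; rewrite E run_nat => /(congr1 (fun h => h ∘ idto (esym (tob1r (mon C) _)))).
by rewrite mcomp0l -mcompA /run idtoK mcompm1.
Qed.

Lemma wdata_tensor_weak (M M' : wdata L) : lie_rinehart_bimonoid L ->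
  is_weak_module M -> is_weak_module M' -> is_weak_module (wdata_tensor M M').
Proof.
move=> LP MP MP'; split.
- exact: rho_tensor_module (weak_module_A MP) (weak_module_A MP').
- exact: gam_tensor_lie (weak_module_L MP) (weak_module_L MP').
exact/weak_compatP/weak_compat_tensor.
Qed.

Section StrictMonoidal.
Hypothesis LP : lie_rinehart_bimonoid L.

Definition weak_tensor (M M' : weak_module L) : weak_module L :=
  WeakModule (wdata_tensor_weak LP (wdatP M) (wdatP M')).

Definition weak_unit : weak_module L := WeakModule (wdata_unit_weak (proj2 LP)).

Definition weak_thom (M N M' N' : weak_module L) (f : weak_hom M N)
    (f' : weak_hom M' N') : weak_hom (weak_tensor M M') (weak_tensor N N') :=
  @WeakHom K C A L (weak_tensor M M') (weak_tensor N N') (whom f ⨂ whom f')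
    (rho_tensor_hom (whom_rho f) (whom_rho f'))
    (gam_tensor_hom (whom_gam f) (whom_gam f')).

Lemma weak_tensorA (M M' M'' : weak_module L) :
  weak_tensor (weak_tensor M M') M'' = weak_tensor M (weak_tensor M' M'').
Proof. exact/weak_module_eq/wdata_tensorA. Qed.

Lemma weak_tensor1l (M : weak_module L) : weak_tensor weak_unit M = M.
Proof. exact/weak_module_eq/wdata_tensor1l. Qed.

Lemma weak_tensor1r (M : weak_module L) : weak_tensor M weak_unit = M.
Proof. exact/weak_module_eq/wdata_tensor1r. Qed.

(** Kept transparent, so that its tensor product and unit compute to the prescribed ones. *)
Definition wmod_monoidal : strict_monoidal (WMod L).
Proof.
apply: (@StrictMonoidal (WMod L) weak_tensor weak_unit weak_thom).
- by move=> M M'; apply: weak_hom_eq; rewrite /= thom_id.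
- by move=> *; apply: weak_hom_eq; rewrite /= thom_comp.
- exact: weak_tensorA.
- exact: weak_tensor1l.
- exact: weak_tensor1r.
- move=> *; apply: weak_hom_same; try exact: weak_tensorA.
  exact: thomA.
- move=> *; apply: weak_hom_same; try exact: weak_tensor1l.
  exact: thom1l.
move=> *; apply: weak_hom_same; try exact: weak_tensor1r.
exact: thom1r.
Defined.

Lemma lr_bimonoid_wmod_monoidal : wmod_strict_monoidal L.
Proof. by exists wmod_monoidal. Qed.

End StrictMonoidal.

(** * The converse: evaluating the axioms at units *)

Definition wdata_self : wdata L := @WData K C A L A (mmul A) (anchor L).

(** The associativity and unit laws of [A] and the anchor axioms [anchor_bracket] and [anchor_mul]
    are exactly the weak-module axioms here. *)
Lemma wdata_self_weak : is_weak_module wdata_self.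
Proof.
split; [split; [exact: mmulA | exact: mmul1l] | exact: anchor_bracket |].
exact: anchor_mul.
Qed.

Lemma one_one : w01 (mone A) A ∘ mone A = (id_ A ⨂ mone A) ∘ w01 (mone A) (I_ C).
Proof. exact: w01_nat. Qed.

Lemma run_one : run_ A ∘ w01 (mone A) (I_ C) = mone A.
Proof.
rewrite w01.unlock mcompA run_nat -mcompA /run idto_comp idto_id.
exact: mcompm1.
Qed.

(* A derivation kills the unit: the Leibniz rule at 1 = 1 * 1 gives
   [x := α(l ⊗ 1)] the equation [x = x + x]. *)
Lemma anchor_one : anchor L ∘ (id_ L ⨂ mone A) = 0.
Proof.
have AP := weak_module_A wdata_self_weak.
have /weak_compatP/= H := weak_module_compat wdata_self_weak.
have Hu : (id_ L ⨂ mmul A) ∘ (id_ L ⨂ (w01 (mone A) A ∘ mone A))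
    = id_ L ⨂ mone A.
  by rewrite -lw_comp mcompA (module_w01 AP) mcomp1m.
have := congr1 (fun h => h ∘ (id_ L ⨂ (w01 (mone A) A ∘ mone A))) H.
rewrite /= -mcompA Hu mcompDl [X in X + _](_ : _ = anchor L ∘ (id_ L ⨂ mone A)).
  rewrite [X in _ + X](_ : _ = anchor L ∘ (id_ L ⨂ mone A)).
    by rewrite -[X in X = _]addr0 => /addrI.
  rewrite lw_comp -!mcompA (reassoc2 _ (sw_w01 _ _ _)) (reassoc2 _ (esym (w01_nat _ _))).
  by rewrite -!mcompA (mcompA (mmul A)) (module_w01 AP) mcomp1m.
rewrite one_one lw_comp -!mcompA (reassoc2 _ (w21_nat _ _)) -!mcompA (mcompA (mmul A)).
by rewrite mmul1r (mcompA (run_ A)) run_w21 -mcompA -lw_comp run_one.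
Qed.

Lemma anchor_onex : w21 (anchor L) (I_ C) ∘ (id_ L ⨂ w01 (mone A) (I_ C)) = 0.
Proof.
have E : idto (esym (tob1r (mon C) A)) ∘ run_ A = id_ _ by exact: idtoK.
rewrite -[LHS]mcomp1m -E -mcompA (mcompA (run_ A)) run_w21 -mcompA -lw_comp.
by rewrite run_one anchor_one mcomp0r.
Qed.

(** The map [a ↦ a ⊗ (1 ⊗ 1)], along which actions of [A] on [A ⊗ A] are evaluated. *)
Let one2 : mor A (A ⊗ (A ⊗ A)) :=
  (id_ A ⨂ (w01 (mone A) A ∘ mone A)) ∘ idto (esym (tob1r (mon C) A)).

Lemma mmul1rx x : w21 (mmul A) x ∘ (id_ A ⨂ w01 (mone A) x) = id_ (A ⊗ x).
Proof.
apply: same_arrow_eq; apply: same_arrow_trans (same_arrow_comp (same_w21 _ _)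
  (same_lw _ (same_w01 _ _))) _.
rewrite -rw_comp mmul1r -thom_id; apply: same_arrow_rw.
by apply: idto_same_id; rewrite tob1r.
Qed.

Lemma run_w12 (a b c : C) (f : mor a (b ⊗ c)) :
  (id_ b ⨂ run_ c) ∘ w12 f (I_ C) = f ∘ run_ a.
Proof.
rewrite -run_nat w12.unlock mcompA; congr (_ ∘ _).
by rewrite thom_idm_idto idto_comp; congr idto; apply: Prop_irrelevance.
Qed.

(** On [1 ⊗ 1] the two copies of [a] made by [Δ] multiply units, and the right unit law returns
    [Δ(a)]. *)
Lemma rho_tensor_one :
  rho_tensor (mmul A) (mmul A) ∘ one2 = cmul A.
Proof.
rewrite rho_tensorE /one2 lw_comp -!mcompA.
do 2![rewrite (reassoc2 _ (w12_nat (cmul A) _)) -!mcompA].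
rewrite (reassoc2 _ (lw_comp2 _ (sw_w01 _ _ _))) (reassoc2 _ (mmul1rx _)) mcomp1m.
rewrite (reassoc2 _ (lw_comp2 _ (mmul1r A))) (reassoc2 _ (run_w12 _)) -mcompA.
by rewrite /run idtoK mcompm1.
Qed.

(** Each of the two summands contains a factor [α(l ⊗ 1)], which is zero. *)
Lemma gam_tensor_one : gam_tensor (anchor L) (anchor L)
  ∘ (id_ L ⨂ (w01 (mone A) A ∘ mone A)) = 0.
Proof.
rewrite gam_tensorE mcompDl -mcompA lw_comp (reassoc2 _ (sw_w01 _ _ _)).
rewrite (reassoc2 _ (esym (w01_nat _ _))) -mcompA anchor_one mcomp0r addr0.
by rewrite -lw_comp one_one lw_comp (reassoc2 _ (w21_nat _ _)) -mcompA anchor_onex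
  mcomp0r.
Qed.

(** Compatibility at [l ⊗ a ⊗ (1 ⊗ 1)] reads [l·Δ(a) = Δ(α(l ⊗ a)) + a·(l·(1 ⊗ 1))], up to braiding,
    and the last term vanishes. *)
Lemma cmul_anchor : is_weak_module (wdata_tensor wdata_self wdata_self) ->
  cmul A ∘ anchor L
    = w21 (anchor L) A ∘ (id_ L ⨂ cmul A)
      + (id_ A ⨂ anchor L) ∘ (sw L A A ∘ (id_ L ⨂ cmul A)).
Proof.
case=> _ _ /weak_compatP /=.
have := gam_tensor_one; have := rho_tensor_one.
have := gam_tensorE (anchor L) (anchor L).
move: (rho_tensor _ _) (gam_tensor _ _) => r g Eg Er Eg0 H.
have := congr1 (fun h => h ∘ (id_ L ⨂ one2)) H; rewrite /= -mcompA -lw_comp.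
rewrite Er {1}Eg !mcompDl -!mcompA => ->.
(* First the anchor term is identified with [Δ ∘ α]; the vanishing of the other term, by
   [gam_tensor_one], is proved last. *)
rewrite [X in _ = _ + X](_ : _ = 0).
  rewrite addr0 -{1}Er -!mcompA; congr (_ ∘ _).
  rewrite /one2 [in RHS]lw_comp (reassoc2 _ (w21_nat _ _)) -!mcompA; congr (_ ∘ _).
  have E : run_ A ∘ idto (esym (tob1r (mon C) A)) = id_ _ by exact: idtoK.
  have E' : idto (esym (tob1r (mon C) A)) ∘ run_ A = id_ _ by exact: idtoK.
  rewrite -[RHS]mcomp1m -E' -!mcompA; congr (_ ∘ _).
  by rewrite mcompA run_w21 -mcompA -lw_comp E thom_id mcompm1.
rewrite /one2 lw_comp (reassoc2 _ (sw_nat _ _ _)) -!mcompA.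
by rewrite (reassoc2 _ (lw_comp2 _ Eg0)) thom0r mcomp0l mcomp0r.
Qed.

(** Objects of [WMod] carry proofs of the weak-module axioms; [ST] and [SU] transport them to the
    prescribed triples on [A ⊗ A] and on the unit. *)
Lemma wmod_monoidal_lr_bimonoid :
  wmod_strict_monoidal L -> lie_rinehart_bimonoid L.
Proof.
case=> S [ST SU _]; split.
  apply/lr_bimonoid_w/cmul_anchor.
  by have := wdatP (tob S (WeakModule wdata_self_weak)
    (WeakModule wdata_self_weak)); rewrite ST.
by apply: anchor_cone_unit; have := wdatP (tunit S); rewrite SU.
Qed.

End Monoidal.

Theorem theorem3p26 (R : realType) (C : linear_ssmc R[i])
    (A : bimonoid C) (L : lie_rinehart A) :
  wmod_strict_monoidal L <-> lie_rinehart_bimonoid L.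
Proof.
split; [exact: wmod_monoidal_lr_bimonoid | exact: lr_bimonoid_wmod_monoidal].
Qed.
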